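(* Let $G$ be an Abelian compact group. Then there exist an ordinal $\kappa$ and a continuous inverse sequence $\mathbb{S}=\langle G_\alpha;p_\alpha^\beta;\kappa\rangle$ in the category of topological groups with $G=\varprojlim\mathbb{S}$ such that $G_0$ is the trivial group and for each $\alpha<\kappa$ either $p_\alpha^{\alpha+1}\colon G_{\alpha+1}\to G_\alpha$ is an epimorphism with a finite kernel or, up to isomorphism, $G_{\alpha+1}=G_\alpha\times\mathbb{T}$ and $p_\alpha^{\alpha+1}$ is the standard projection onto $G_\alpha$. Furthermore, if $G$ is not a Lie group then $\kappa=\operatorname{w}(G)$.
   Context: Compact groups are compact Hausdorff topological groups; an epimorphism is a continuous surjective homomorphism. $\mathbb{T}$ is the circle group. A compact Lie group is a compact group having a neighborhood of the identity that contains no nontrivial subgroups. $\operatorname{w}(G)$ denotes the topological weight of $G$ (least cardinality of a base). A continuous inverse sequence $\langle G_\alpha; p_\alpha^\beta;\kappa\rangle$ with limit $G$ consists of compact groups $G_\alpha$ ($\alpha\leqslant\kappa$), with $G_\kappa=G$, and continuous homomorphisms $p_\alpha^\beta\colon G_\beta\to G_\alpha$ ($\alpha\leqslant\beta\leqslant\kappa$) with $p_\alpha^\alpha=\mathrm{id}$ and $p_\alpha^\beta\circ p_\beta^\gamma=p_\alpha^\gamma$ for $\alpha\leqslant\beta\leqslant\gamma$, such that for every limit ordinal $\delta\leqslant\kappa$ the group $G_\delta$ together with the maps $p_\alpha^\delta$ ($\alpha<\delta$) is the inverse limit of $\langle G_\alpha;p_\alpha^\beta\rangle_{\alpha\leqslant\beta<\delta}$.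 ''Up to isomorphism, $G_{\alpha+1}=G_\alpha\times\mathbb{T}$ and $p_\alpha^{\alpha+1}$ is the standard projection'' means that there is an isomorphism of topological groups $h\colon G_{\alpha+1}\to G_\alpha\times\mathbb{T}$ with $\operatorname{pr}_{G_\alpha}\circ h=p_\alpha^{\alpha+1}$. *)

(* Defs.v *)
From HB Require Import structures.
From mathcomp Require Import all_boot all_order all_algebra complex.
From mathcomp Require Import all_classical all_reals all_analysis.
From mathcomp Require wochoice.

Set Implicit Arguments.
Unset Strict Implicit.
Unset Printing Implicit Defensive.

Import Order.TTheory GRing.Theory Num.Theory.
Import numFieldNormedType.Exports.

Local Open Scope classical_set_scope.
Local Open Scope card_scope.
Local Open Scope group_scope.

HB.mixin Record Group_isTopologicalGroup G of Group G & Topological G := {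
  mulg_continuous : continuous (fun x : G * G => x.1 * x.2);
  invg_continuous : continuous (fun x : G => x^-1)
}.

#[short(type="topologicalGroupType")]
HB.structure Definition TopologicalGroup :=
  {G of Group G & Topological G & Group_isTopologicalGroup G}.

Section ProductTopologicalGroup.
Variables G H : topologicalGroupType.

Let pair_mulg_continuous :
  continuous (fun x : (G * H) * (G * H) => x.1 * x.2).
Proof.
move=> x; have -> : (fun x : (G * H) * (G * H) => x.1 * x.2)
    = (fun x => (x.1.1 * x.2.1, x.1.2 * x.2.2)) by [].
apply: cvg_pair => /=.
- apply: (@continuous_comp _ _ _ (fun x : (G * H) * (G * H) => (x.1.1, x.2.1))
    (fun y : G * G => y.1 * y.2)); last exact: mulg_continuous.
  apply: cvg_pair => /=.
    by apply: (@continuous_comp _ _ _ fst fst); exact: cvg_fst.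
  by apply: (@continuous_comp _ _ _ snd fst); [exact: cvg_snd|exact: cvg_fst].
- apply: (@continuous_comp _ _ _ (fun x : (G * H) * (G * H) => (x.1.2, x.2.2))
    (fun y : H * H => y.1 * y.2)); last exact: mulg_continuous.
  apply: cvg_pair => /=.
    by apply: (@continuous_comp _ _ _ fst snd); [exact: cvg_fst|exact: cvg_snd].
  by apply: (@continuous_comp _ _ _ snd snd); exact: cvg_snd.
Qed.

Let pair_invg_continuous : continuous (fun x : G * H => x^-1).
Proof.
move=> x; have -> : (fun x : G * H => x^-1) = (fun x => (x.1^-1, x.2^-1)) by [].
apply: cvg_pair => /=.
- by apply: (@continuous_comp _ _ _ fst (fun y : G => y^-1));
    [exact: cvg_fst|exact: invg_continuous].
- by apply: (@continuous_comp _ _ _ snd (fun y : H => y^-1));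
    [exact: cvg_snd|exact: invg_continuous].
Qed.

HB.instance Definition _ := Group_isTopologicalGroup.Build (G * H)%type
  pair_mulg_continuous pair_invg_continuous.

End ProductTopologicalGroup.

Definition unit_circle (C : numClosedFieldType) : Type :=
  [set z : C | `|z| = 1]%R.

Section UnitCircle.
Variable C : numClosedFieldType.
Local Notation T := (unit_circle C).

HB.instance Definition _ := Choice.on T.
HB.instance Definition _ := Topological.on T.

Let coe (z : T) : C := set_val z.

Let coe_norm (z : T) : (`|coe z| = 1)%R.
Proof. exact: (set_valP z). Qed.

Let coe_neq0 (z : T) : (coe z != 0)%R.
Proof. by rewrite -normr_eq0 coe_norm oner_eq0. Qed.

Let mk (z : C) (z1 : (`|z| = 1)%R) : T := SigSub (mem_set z1).

Let coe_inj : injective coe. Proof. exact: val_inj. Qed.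

Let one_norm : (`|1 : C| = 1)%R. Proof. exact: normr1. Qed.

Let mul_norm (x y : T) : (`|coe x * coe y| = 1)%R.
Proof. by rewrite normrM !coe_norm mulr1. Qed.

Let inv_norm (x : T) : (`|(coe x)^-1| = 1)%R.
Proof. by rewrite normfV coe_norm invr1. Qed.

Definition unit_circle_one : T := mk one_norm.
Definition unit_circle_mul (x y : T) : T := mk (mul_norm x y).
Definition unit_circle_inv (x : T) : T := mk (inv_norm x).

Let mulA : associative unit_circle_mul.
Proof. by move=> x y z; apply: coe_inj; exact: mulrA. Qed.

Let mul1 : left_id unit_circle_one unit_circle_mul.
Proof. by move=> x; apply: coe_inj; exact: mul1r. Qed.

Let mulx1 : right_id unit_circle_one unit_circle_mul.
Proof. by move=> x; apply: coe_inj; exact: mulr1. Qed.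

Let mulV : left_inverse unit_circle_one unit_circle_inv unit_circle_mul.
Proof. by move=> x; apply: coe_inj; exact: (mulVf (coe_neq0 x)). Qed.

Let mulxV : right_inverse unit_circle_one unit_circle_inv unit_circle_mul.
Proof. by move=> x; apply: coe_inj; exact: (mulfV (coe_neq0 x)). Qed.

HB.instance Definition _ := isGroup.Build T mulA mul1 mulx1 mulV mulxV.

Let coe_continuous : continuous coe.
Proof. exact: initial_continuous. Qed.

Let unit_circle_mul_continuous : continuous (fun x : T * T => x.1 * x.2).
Proof.
apply: (@continuous_comp_initial _ _ _ (@set_val _ [set z : C | `|z| = 1]%R)).
move=> x; apply: (@cvgM _ _ (nbhs x) _ (coe \o fst) (coe \o snd)).
  by apply: continuous_comp; [exact: cvg_fst|exact: coe_continuous].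
by apply: continuous_comp; [exact: cvg_snd|exact: coe_continuous].
Qed.

Let unit_circle_inv_continuous : continuous (fun x : T => x^-1).
Proof.
apply: (@continuous_comp_initial _ _ _ (@set_val _ [set z : C | `|z| = 1]%R)).
move=> x; apply: (@cvgV _ _ (nbhs x) _ coe (coe x)); first exact: coe_neq0.
exact: coe_continuous.
Qed.

HB.instance Definition _ := Group_isTopologicalGroup.Build T
  unit_circle_mul_continuous unit_circle_inv_continuous.

End UnitCircle.

Definition circle_group (R : realType) : topologicalGroupType :=
  unit_circle (R[i]).

Section TopologicalGroups.
Implicit Types G H : topologicalGroupType.

Definition compact_group G : Prop := compact [set: G] /\ hausdorff_space G.

Definition abelian_group G : Prop := forall x y : G, x * y = y * x.

Definition trivial_group G : Prop := forall x : G, x = 1.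

Definition compact_lie_group G : Prop :=
  compact_group G /\
  exists2 U : set G, nbhs (1 : G) U &
    forall K : set G, group_closed [in K] -> K `<=` U -> K = [set 1].

Definition continuous_hom G H (f : G -> H) : Prop :=
  continuous f /\ {morph f : x y / x * y}.

Definition epimorphism G H (f : G -> H) : Prop :=
  continuous_hom f /\ set_surj [set: G] [set: H] f.

Definition kernel G H (f : G -> H) : set G := [set x | f x = 1].

Definition topological_isomorphism G H (h : G -> H) : Prop :=
  continuous_hom h /\
  exists g : H -> G, [/\ continuous_hom g, cancel h g & cancel g h].

End TopologicalGroups.

(* An ordinal kappa is represented by a well-ordered type I of order type
   kappa + 1: the elements of I are the ordinals alpha <= kappa, with 0 = \bot
   and kappa = \top.  As I has a top element, every ordinal arises this way and
   the order type of I determines kappa. *)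
Section Ordinals.
Context {d : Order.disp_t} {I : tbOrderType d}.

Definition is_successor (a b : I) : Prop :=
  (a < b)%O /\ forall c : I, (a < c)%O -> (b <= c)%O.

Definition is_limit_ordinal (a : I) : Prop :=
  (\bot < a)%O /\ ~ exists b : I, is_successor b a.

Definition below (a : I) : set I := [set b | (b < a)%O].

Definition is_cardinal (a : I) : Prop :=
  forall b : I, (b < a)%O -> ~~ (below b #= below a).

(* w(T) = a, cardinals being identified with initial ordinals *)
Definition weight_eq (T : topologicalType) (a : I) : Prop :=
  [/\ is_cardinal a,
      exists2 B : set (set T), basis B & below a #= B &
      forall B : set (set T), basis B -> below a #<= B].

End Ordinals.

Record inverse_sequence (d : Order.disp_t) (I : tbOrderType d) :=
  InverseSequence {
    obj :> I -> topologicalGroupType;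
    bond : forall a b : I, (a <= b)%O -> obj b -> obj a;
    obj_compact : forall a, compact_group (obj a);
    bond_hom : forall a b (ab : (a <= b)%O), continuous_hom (bond ab);
    bond_id : forall a (aa : (a <= a)%O) x, bond aa x = x;
    bond_comp : forall a b c (ab : (a <= b)%O) (bc : (b <= c)%O)
      (ac : (a <= c)%O) x, bond ab (bond bc x) = bond ac x
  }.
Arguments bond {d I} S {a b} ab x : rename.

Section InverseSequences.
Context {d : Order.disp_t} {I : tbOrderType d}.
Variable S : inverse_sequence I.

(* universal property of (S delta, bonding maps) as the limit, in the category
   of topological groups, of the restriction of S to the ordinals < delta *)
Definition is_inverse_limit_at (delta : I) : Prop :=
  forall (X : topologicalGroupType) (f : forall a, (a < delta)%O -> X -> S a),
    (forall a (ad : (a < delta)%O), continuous_hom (f a ad)) ->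
    (forall a b (ab : (a <= b)%O) (ad : (a < delta)%O) (bd : (b < delta)%O) x,
      bond S ab (f b bd x) = f a ad x) ->
  exists! u : X -> S delta, continuous_hom u /\
    forall a (ad : (a < delta)%O) x, bond S (ltW ad) (u x) = f a ad x.

Definition continuous_sequence : Prop :=
  forall delta : I, is_limit_ordinal delta -> is_inverse_limit_at delta.

Definition finite_kernel_step (a b : I) (ab : (a <= b)%O) : Prop :=
  epimorphism (bond S ab) /\ finite_set (kernel (bond S ab)).

Definition circle_step (R : realType) (a b : I) (ab : (a <= b)%O) : Prop :=
  exists h : S b -> (S a * circle_group R)%type,
    topological_isomorphism h /\ forall x, (h x).1 = bond S ab x.

End InverseSequences.

(* Main.v *)
Require Import Defs.
From HB Require Import structures.
From mathcomp Require Import all_boot all_order all_algebra complex.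
From mathcomp Require Import generic_quotient.
From mathcomp Require Import all_classical all_reals all_analysis.
From mathcomp Require wochoice.
From mathcomp Require Import ring lra.
Import Order.TTheory.

Set Implicit Arguments.
Unset Strict Implicit.
Unset Printing Implicit Defensive.
Import GRing.Theory Num.Theory.
Import numFieldNormedType.Exports.
Import ComplexField.Normc.

Local Open Scope classical_set_scope.

(** Write T for the circle group.  A compact abelian group G has enough
    characters, that is, continuous homomorphisms into T, to separate its points.
    Given characters chi_b indexed by the ordinals b < kappa which together
    separate points, put N_a := the intersection of the kernels of the chi_b
    with b < a, and G_a := G / N_a.  Then N_0 = G, N_kappa is trivial, and at
    limit ordinals N_d is the intersection of the earlier N_a; by compactness this
    makes G_d the inverse limit of the G_a ([character_system_continuous]).  The
    kernel of G_(a+1) -> G_a is N_a / (N_a meet ker chi_a), which chi_a embeds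
    onto the closed subgroup chi_a(N_a) of T.  A closed subgroup of T is finite or
    all of T ([circle_closed_subgroup]).  If chi_a(N_a) is finite, so is the kernel;
    if it is T, then x |-> (x mod N_a, chi_a x) induces an isomorphism of G_(a+1)
    onto G_a * T: it is injective by the choice of N_(a+1), and surjective because
    the second coordinate can be corrected by an element of N_a without changing the
    first ([character_system_step]).

    The weight is attained as follows.  Let B be a base of minimal cardinality,
    indexed by the corresponding initial ordinal ([exists_weight_order]).  For each
    U in B choose a character which is nowhere 1 on U whenever there is one.  If
    x <> 1, some character is not 1 at x, hence on a whole basic neighbourhood U of
    x, so the character chosen for U is not 1 at x either.  Hence kappa = w(G)
    many characters separate points.

    That characters separate points ([exists_character]) is a form of the
    Peter-Weyl theorem.  An invariant mean m on the bounded functions of G,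
    obtained as an ultrafilter limit of finite averages, serves as a Haar
    integral on continuous functions.  Given g <> 1, take an even continuous k with
    k 1 <> k g and convolve with phi x := 2 k x - k (g x) - k (g^-1 x).  This
    convolution is a nonzero symmetric operator which kills every function
    invariant under g.  By equicontinuity it is compact, so its square has an
    eigenfunction for a positive eigenvalue mu ([exists_eigenfunction]); by
    Bessel's inequality the eigenspace is finite-dimensional ([exists_eigenbasis]).
    Translations act on it by commuting matrices, which over the complex numbers
    have a common eigenvector w.  Then w (t x) = c t * w x, so c = w / w 1 is a
    character, and c g = 1 would make w invariant under g, hence killed by
    the convolution, contradicting mu <> 0. *)

(** * Well orders and the weight *)

Lemma well_order_least (X : choiceType) (R : rel X)
    (Rwo : wochoice.well_order R) (P : set X) :
  P !=set0 -> exists2 x, P x & forall y, P y -> R x y.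
Proof.
move=> [x Px].
have [|m [[Pm mmin] _]] := @Rwo [pred x | `[<P x>]].
  by exists x; apply/asboolP.
exists m; first by apply/asboolP.
by move=> y Py; apply: mmin; apply/asboolP.
Qed.

Section WellOrderSegments.
Local Open Scope card_scope.
Variables (X : choiceType) (R : rel X).
Hypothesis Rwo : wochoice.well_order R.

Let lt (x y : X) : Prop := R x y /\ x <> y.

Let R_total : total R.
Proof. by move=> x y; apply: (wochoice.wo_chainW (C := predT)) => // A _; exact: Rwo. Qed.

Let R_refl : reflexive R.
Proof. by move=> x; have := R_total x x; rewrite orbb. Qed.

Let R_anti : antisymmetric R.
Proof.
move=> x y; apply: (@wochoice.wo_chain_antisymmetric X R predT) => // A _; exact: Rwo.
Qed.

Let wo_least (P : set X) : P !=set0 ->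
  exists2 x, P x & forall y, P y -> R x y.
Proof. exact: well_order_least. Qed.

Lemma wo_trans : transitive R.
Proof.
move=> y x z xy yz.
have [|m mP mmin] := @wo_least [set w | w = x \/ w = y \/ w = z]; first by exists x; left.
have Rmx : R m x by apply: mmin; left.
have Rmy : R m y by apply: mmin; right; left.
have Rmz : R m z by apply: mmin; right; right.
case: mP => [<-//|[my|mz]].
  by suff -> : x = y by []; apply: R_anti; rewrite xy -my.
have zy : y = z by apply: R_anti; rewrite yz -mz.
by rewrite -zy.
Qed.

Let lt_wf : well_founded lt.
Proof.
move=> x; apply: contrapT => nx.
have [m /= nm mmin] := @wo_least [set x | ~ Acc lt x] (ex_intro _ x nx).
apply: nm; constructor=> y [ym nym]; apply: contrapT => ny.
by apply: nym; apply: R_anti; rewrite ym mmin.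
Qed.

Definition initial_segment (S : set X) := forall x y, R x y -> S y -> S x.

Let least (P : set X) (x0 : X) : X :=
  if pselect (P !=set0) is left ne then sval (cid2 (wo_least ne)) else x0.

Let leastP P x0 : P !=set0 -> P (least P x0) /\ forall y, P y -> R (least P x0) y.
Proof. by rewrite /least; case: pselect => // ne _; case: cid2. Qed.

(** Transfinite recursion collapses a subset A of a well-ordered set onto an
    initial segment: each element of A is sent to the first value not taken by
    its predecessors in A.  The value never exceeds the argument, so a free value
    always exists. *)
Section Rank.
Variable A : set X.

Let rank : X -> X := Fix lt_wf (fun=> X) (fun a rec =>
  least [set x | forall b (ba : lt b a), A b -> x <> rec b ba] a).

Let rankE a : rank a = least [set x | forall b, lt b a -> A b -> x <> rank b] a.
Proof.
rewrite /rank Fix_eq // => x f g fg.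
suff -> : f = g by [].
by apply: functional_extensionality_dep => y; apply: functional_extensionality_dep.
Qed.

Let rank_spec a :
  [/\ R (rank a) a, forall b, lt b a -> A b -> rank a <> rank b &
      forall y, (forall b, lt b a -> A b -> y <> rank b) -> R (rank a) y].
Proof.
elim: {a}(lt_wf a) => a _ IH.
have [|Pr minr] := @leastP [set x | forall b, lt b a -> A b -> x <> rank b] a.
  exists a => b [Rba nba] _ ab.
  have [/= + _ _] := IH b (conj Rba nba); rewrite -ab => Rab.
  by apply: nba; apply: R_anti; rewrite Rba.
rewrite -rankE in Pr minr; split => //; apply: minr => b [Rba nba] _ ab.
have [/= + _ _] := IH b (conj Rba nba); rewrite -ab => Rab.
by apply: nba; apply: R_anti; rewrite Rba.
Qed.

Lemma card_eq_initial_segment : exists2 S, initial_segment S & S #= A.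
Proof.
exists (rank @` A); last first.
  apply/inj_card_eq => a b /set_mem Aa /set_mem Ab rab; apply: contrapT => nab.
  have /orP[Rab|Rba] := R_total a b.
    by have [_ /(_ a (conj Rab nab) Aa)] := rank_spec b; rewrite rab.
  by have [_ /(_ b (conj Rba (nesym nab)) Ab)] := rank_spec a; rewrite rab.
move=> x y Rxy [a Aa ay]; move: Rxy; rewrite -{}ay => Rxa.
have [xra|nxra] := pselect (x = rank a); first by exists a.
have [_ _ rmin] := rank_spec a.
apply: contrapT => nx; apply: nxra; apply: R_anti; rewrite Rxa /=.
by apply: rmin => b _ Ab xb; apply: nx; exists b.
Qed.

End Rank.

(** Initial segments are well ordered by inclusion, since a proper one is
    determined by the first element which it omits. *)
Lemma least_initial_segment (P : set (set X)) :
  (exists2 S, initial_segment S & P S) ->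
  exists2 S0, initial_segment S0 /\ P S0 &
    forall S, initial_segment S -> P S -> S0 `<=` S.
Proof.
move=> [S1 iS1 PS1].
pose seg b := [set x | lt x b].
have segP S : initial_segment S -> S = setT \/ exists b, S = seg b.
  move=> iS; have [ne|e] := pselect (~` S !=set0); last first.
    by left; rewrite -[S]setCK -setC0; congr (~` _); apply: contrapT => /eqP/set0P.
  right; have [b nSb bmin] := wo_least ne; exists b; apply/seteqP; split => x.
    move=> Sx; have /orP[Rxb|Rbx] := R_total x b; last by have /nSb := iS _ _ Rbx Sx.
    by split=> // xb; apply: nSb; rewrite -xb.
  by move=> [Rxb nxb]; apply: contrapT => /bmin Rbx; apply: nxb; apply: R_anti; rewrite Rxb.
have iseg b : initial_segment (seg b).
  move=> x y Rxy [Ryb nyb]; split; first exact: wo_trans Rxy Ryb.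
  by move=> xb; apply: nyb; apply: R_anti; rewrite Ryb -xb.
have [[b0 Pb0]|nP] := pselect (exists b, P (seg b)).
  have [b Pb bmin] := @wo_least [set b | P (seg b)] (ex_intro _ b0 Pb0).
  exists (seg b) => // S /segP[->//|[c ->]] /bmin Rbc x [Rxb nxb]; split.
    exact: wo_trans Rxb Rbc.
  by move=> xc; apply: nxb; apply: R_anti; rewrite Rxb xc.
exists S1 => // S iS PS; case/segP: (iS) => [->//|[b Sb]].
by case: nP; exists b; rewrite -Sb.
Qed.

(** The ordinal S + 1.  The proof that R is a well order is a parameter so that the
    order structures below can be inferred from the type alone. *)
Definition add_top (_ : wochoice.well_order R) (S : set X) : Type := option {x | x \in S}.

Section AddTop.
Variable S : set X.
Local Notation I := (add_top Rwo S).

Definition add_top_le (a b : I) : bool :=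
  match a, b with
  | Some x, Some y => R (val x) (val y)
  | Some _, None => true
  | None, b => b == None
  end.

Let le_refl : reflexive add_top_le.
Proof. by case=> [x|] //=; exact: R_refl. Qed.

Let le_trans : transitive add_top_le.
Proof. by move=> [y|] [x|] [z|] //=; exact: wo_trans. Qed.

Let le_anti : antisymmetric add_top_le.
Proof. by move=> [x|] [y|] //= /R_anti/val_inj ->. Qed.

Let le_total : total add_top_le.
Proof. by move=> [x|] [y|] //=; exact: R_total. Qed.

Lemma add_top_wo : wochoice.well_order add_top_le.
Proof.
apply: wochoice.antisymmetric_well_order => // A [a Aa].
have [ne|e] := pselect ([set x | exists y, val y = x /\ Some y \in A] !=set0).
  have [_ [y [<- Ay]] ymin] := wo_least ne.
  by exists (Some y); split => // -[z|] Az //=; apply: ymin; exists z.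
exists a; split=> // b Ab; move: Ab Aa; case: b => [b|]; case: a => [a|] //.
- by move=> Ab; case: e; exists (val b), b.
- by move=> Ab; case: e; exists (val b), b.
Qed.

HB.instance Definition _ := Choice.on I.
HB.instance Definition _ :=
  Order.Le_isPOrder.Build (Order.Disp tt tt) I le_refl le_anti le_trans.
HB.instance Definition _ := Order.POrder_isTotal.Build _ I le_total.

Let bot : I := sval (cid2 (@well_order_least I add_top_le add_top_wo setT
  (ex_intro _ None Logic.I))).

Let le0x (a : I) : (bot <= a)%O.
Proof. by rewrite /bot; case: cid2 => b /= _; exact. Qed.

Let lex1 (a : I) : (a <= None :> I)%O.
Proof. by case: a. Qed.

HB.instance Definition _ := Order.hasBottom.Build _ I le0x.
HB.instance Definition _ := Order.hasTop.Build _ I lex1.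

End AddTop.
End WellOrderSegments.

Section WeightOrder.
Local Open Scope card_scope.

(** Brings cardinals of lower sets of S + 1 back to subsets of X, where initial
    segments can be compared. *)
Lemma card_below_add_top (X : choiceType) (R : rel X) (Rwo : wochoice.well_order R)
    (S : set X) (a : add_top Rwo S) :
  below a #= [set x | exists2 y : {x | x \in S}, ((Some y : add_top Rwo S) < a)%O & val y = x].
Proof.
pose E : set {x | x \in S} := [set y | ((Some y : add_top Rwo S) < a)%O].
have -> : below a = Some @` E.
  apply/seteqP; split=> [[y|] ya|_ [y Ey <-]//]; first by exists y.
  by move: ya; rewrite /below /= ltNge lex1.
have -> : [set x | exists2 y : {x | x \in S},
    ((Some y : add_top Rwo S) < a)%O & val y = x] = val @` E.
  by apply/seteqP; split=> x [y ya <-]; exists y.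
by rewrite (card_eql card_some) card_eq_sym; apply: inj_card_eq; apply: in2W; exact: val_inj.
Qed.

(** Every base of T is a subset of one well-ordered type, hence equipotent to an
    initial segment of it; the least initial segment which is equipotent to some
    base is an initial ordinal and is the weight. *)
Lemma exists_weight_order (T : topologicalType) :
  exists (d : Order.disp_t) (I : tbOrderType d),
    wochoice.well_order (fun a b : I => (a <= b)%O) /\ weight_eq T (\top%O : I).
Proof.
have [R Rwo] := wochoice.well_ordering_principle (set T).
pose P (S : set (set T)) := exists2 B : set (set T), basis B & S #= B.
have [|S0 [iS0 [B0 B0b S0B0]] S0min] := @least_initial_segment _ R Rwo P.
  have [S iS SB] := card_eq_initial_segment Rwo (@open T).
  exists S => //; exists open => //; split=> //.
  by move=> x U; rewrite nbhsE => -[V [oV Vx] VU]; exists V.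
pose I : tbOrderType _ := add_top Rwo S0.
exists _, I; split; first exact: add_top_wo.
have top_card : below (\top%O : I) #= S0.
  rewrite (card_eql (card_below_add_top _)).
  have -> // : [set x | exists2 y : {x | x \in S0}, ((Some y : I) < \top)%O & val y = x] = S0.
  apply/seteqP; split=> [_ [[y yS] _ <-]|x Sx]; first exact: set_mem.
  by exists (exist _ x (mem_set Sx)).
split; last 1 first.
- move=> B Bb; rewrite (card_le_eql top_card).
  have [S iS SB] := card_eq_initial_segment Rwo B.
  rewrite -(card_le_eqr SB); apply: subset_card_le; apply: S0min => //.
  by exists B.
- case=> [[x xS]|//] _; apply/negP; rewrite (card_eqr top_card) => h.
  rewrite (card_eql (card_below_add_top _)) in h.
  set S := (X in X #= _) in h.
  have iS : initial_segment R S.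
    move=> y z Ryz [[w wS] wx /= wz]; rewrite -{z}wz in Ryz.
    have yS : y \in S0 by apply/mem_set/(iS0 _ _ Ryz)/set_mem.
    exists (exist _ y yS) => //; apply: le_lt_trans wx; exact: Ryz.
  (* The elements below x form a smaller segment equipotent to a base. *)
  have PS : P S by exists B0 => //; rewrite (card_eql h).
  have [[y yS] yx /= xy] := S0min S iS PS x (set_mem xS).
  by move: yx; have -> : exist _ y yS = exist (fun x => x \in S0) x xS;
    [exact: val_inj|rewrite ltxx].
- by exists B0 => //; rewrite (card_eql top_card).
Qed.

End WeightOrder.

(** * Continuity of pointwise and group operations *)

Section ContinuousOps.
Local Open Scope ring_scope.
Context {R : realType} {T : topologicalType}.
Implicit Types f g : T -> R.

Lemma continuous_add f g : continuous f -> continuous g -> continuous (fun x => f x + g x).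
Proof. by move=> fc gc x; apply: cvgD; [exact: fc|exact: gc]. Qed.

Lemma continuous_sub f g : continuous f -> continuous g -> continuous (fun x => f x - g x).
Proof. by move=> fc gc x; apply: cvgB; [exact: fc|exact: gc]. Qed.

Lemma continuous_mul f g : continuous f -> continuous g -> continuous (fun x => f x * g x).
Proof. by move=> fc gc x; apply: cvgM; [exact: fc|exact: gc]. Qed.

Lemma continuous_scale c f : continuous f -> continuous (fun x => c * f x).
Proof. by move=> fc; apply: continuous_mul => // x; exact: cvg_cst. Qed.

Lemma continuous_sum (I : Type) (r : seq I) (f : I -> T -> R) :
  (forall i, continuous (f i)) -> continuous (fun x => \sum_(i <- r) f i x).
Proof.
move=> fc; elim: r => [|i r IH].
  under [X in continuous X]eq_fun do rewrite big_nil.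
  by move=> x; exact: cvg_cst.
under [X in continuous X]eq_fun do rewrite big_cons.
exact: continuous_add.
Qed.

Lemma continuous_lincomb (k : nat) (a : 'I_k -> R) (u : 'I_k -> T -> R) :
  (forall i, continuous (u i)) -> continuous (fun x => \sum_i a i * u i x).
Proof. by move=> uc; apply: continuous_sum => i; exact: continuous_scale. Qed.

End ContinuousOps.

Section GroupContinuity.
Variable G : topologicalGroupType.
Local Open Scope group_scope.

Lemma continuous_mulg (T : topologicalType) (f g : T -> G) :
  continuous f -> continuous g -> continuous (fun x => f x * g x).
Proof.
move=> fc gc x.
apply: (continuous_comp (f := fun x => (f x, g x)) (g := fun z : G * G => z.1 * z.2)).
  by apply: cvg_pair; [exact: fc|exact: gc].
exact: mulg_continuous.
Qed.

Lemma continuous_invg (T : topologicalType) (f : T -> G) :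
  continuous f -> continuous (fun x => (f x)^-1).
Proof.
move=> fc x; apply: (continuous_comp (f := f) (g := fun z => z^-1)); first exact: fc.
exact: invg_continuous.
Qed.

Lemma continuous_translate (T : topologicalType) (f : G -> T) t :
  continuous f -> continuous (fun x => f (t * x)).
Proof.
move=> fc x; apply: (continuous_comp (f := fun x => t * x)); last exact: fc.
by apply: continuous_mulg => y; [exact: cvg_cst|exact: cvg_id].
Qed.
End GroupContinuity.

(** * Invariant means on abelian groups *)

Section SupersetFilter.
Variable K : eqType.

(** The filter of the directed set of finite lists: a property holds eventually if
    it holds for every list containing some fixed finite list. *)
Definition superset_filter : set_system (seq K) :=
  filter_from [set: seq K] (fun Q : seq K => [set P : seq K | {subset Q <= P}]).

Global Instance superset_filter_proper : ProperFilter superset_filter.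
Proof.
apply: filter_from_proper; last by move=> Q _; exists Q.
apply: filter_from_filter; first by exists [::].
move=> Q Q' _ _; exists (Q ++ Q') => // P QP.
by split=> q qQ; apply: QP; rewrite mem_cat qQ ?orbT.
Qed.

Lemma near_superset_mem (q : K) : \forall P \near superset_filter, q \in P.
Proof. by exists [:: q] => // P; apply; rewrite mem_head. Qed.

End SupersetFilter.

(** Covering a given point is eventually true in the filter of finite lists, near
    that point; compactness makes it uniform. *)
Lemma compact_finite_cover (T : topologicalType) (V : T -> set T) :
  compact [set: T] -> (forall x, nbhs x (V x)) ->
  exists s : seq T, forall x, exists2 a, a \in s & V a x.
Proof.
move=> /compact_near_coveringP cov nV.
have [|Q _ QV] := cov (seq T) (@superset_filter T)
    (fun s x => exists2 a, a \in s & V a x) _.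
  move=> a _; exists (V a, [set s : seq T | a \in s]).
    by split; [exact: nV|exact: near_superset_mem].
  by move=> [x s] [Vx sa]; exists a.
by exists Q => x; apply: QV.
Qed.

Section UltraLimit.
Context {R : realType} {J : Type} (U : set_system J) {UU : UltraFilter U}.
Local Open Scope ring_scope.

Lemma ultra_bounded_cvg (f : J -> R) M :
  (\forall j \near U, `|f j| <= M) -> cvg (f @ U).
Proof.
move=> fM; have [|p [_ fp]] := @segment_compact R (- M) M (f @ U) _.
  apply: filterS fM => j; rewrite ler_norml => /andP[? ?] /=; by rewrite in_itv/=; apply/andP.
apply/cvg_ex; exists p => V nV.
have [//|nVU] := in_ultra_setVsetC (f @^-1` V) UU.
by have [x [nVx Vx]] := fp (~` V) V nVU nV.
Qed.

End UltraLimit.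

Section Means.
Context {R : realType} {T : Type}.
Local Open Scope ring_scope.
Implicit Types f g : T -> R.

Definition bounded_function f := exists M, forall x, `|f x| <= M.

Lemma bounded_cst c : bounded_function (fun=> c).
Proof. by exists `|c|. Qed.

Lemma bounded_add f g : bounded_function f -> bounded_function g ->
  bounded_function (fun x => f x + g x).
Proof.
move=> [M fM] [N gN]; exists (M + N) => x.
by rewrite (le_trans (ler_normD _ _))// lerD.
Qed.

Lemma bounded_mul f g : bounded_function f -> bounded_function g ->
  bounded_function (fun x => f x * g x).
Proof.
by move=> [M fM] [N gN]; exists (M * N) => x; rewrite normrM ler_pM.
Qed.

Lemma bounded_comp f (p : T -> T) : bounded_function f -> bounded_function (fun x => f (p x)).
Proof. by move=> [M fM]; exists M => x. Qed.

Lemma bounded_sum (I : Type) (r : seq I) (f : I -> T -> R) :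
  (forall i, bounded_function (f i)) -> bounded_function (fun x => \sum_(i <- r) f i x).
Proof.
move=> fb; elim: r => [|i r IH].
  by exists 0 => x; rewrite big_nil normr0.
have [M iM] := bounded_add (fb i) IH; exists M => x.
by rewrite big_cons.
Qed.

End Means.

(** Being defined on all bounded functions, and not only on continuous ones, a mean
    can be evaluated on indicator functions; [mean_exchange] relies on that. *)
Record invariant_mean (R : realType) (G : groupType) := InvariantMean {
  mean :> (G -> R) -> R;
  mean_cst : forall c, mean (fun=> c) = c;
  mean_add : forall f g, bounded_function f -> bounded_function g ->
    mean (fun x => f x + g x)%R = (mean f + mean g)%R;
  mean_scale : forall c f, bounded_function f ->
    mean (fun x => c * f x)%R = (c * mean f)%R;
  mean_ge0 : forall f, bounded_function f -> (forall x, 0 <= f x)%R -> (0 <= mean f)%R;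
  mean_translate : forall t f, bounded_function f -> mean (fun x => f (t * x)%g) = mean f
}.

Section MeanExists.
Variables (R : realType) (G : groupType).
Hypothesis mulgC : forall x y : G, (x * y = y * x)%g.
Local Open Scope ring_scope.

Definition average (t : G) (n : nat) (f : G -> R) (x : G) : R :=
  n.+1%:R^-1 * \sum_(i < n.+1) f (t ^+ i * x)%g.

(** Composite of the averages over the powers 1, t, .., t ^+ n for the pairs (t, n)
    in P: the average over a box of a finitely generated subgroup. *)
Definition averages (P : seq (G * nat)) (f : G -> R) : G -> R :=
  foldr (fun tn => average tn.1 tn.2) f P.

Lemma average_le t n f g x : (forall x, f x <= g x) -> average t n f x <= average t n g x.
Proof. by move=> fg; rewrite ler_wpM2l ?invr_ge0// ler_sum. Qed.

Lemma average_cst t n c x : average t n (fun=> c) x = c.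
Proof.
rewrite /average sumr_const card_ord -[c *+ _]mulr_natl mulrA mulVf ?mul1r//.
Qed.

Lemma averages_cst P c x : averages P (fun=> c) x = c.
Proof.
elim: P x => //= tn P IH x; rewrite -[RHS](average_cst tn.1 tn.2 c x).
by congr (average _ _ _ _); apply/funext.
Qed.

Lemma averages_le P f g x : (forall x, f x <= g x) -> averages P f x <= averages P g x.
Proof. by move=> fg; elim: P x => //= tn P IH x; apply: average_le. Qed.

Lemma averages_add P f g x :
  averages P (fun x => f x + g x) x = averages P f x + averages P g x.
Proof.
elim: P x => //= tn P IH x; rewrite /average -mulrDr -big_split/=; congr (_ * _).
by apply: eq_bigr => i _; rewrite IH.
Qed.

Lemma averages_scale P c f x : averages P (fun x => c * f x) x = c * averages P f x.
Proof.
elim: P x => //= tn P IH x; rewrite /average mulrCA; congr (_ * _); rewrite mulr_sumr.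
by apply: eq_bigr => i _; rewrite IH.
Qed.

Lemma averages_bound P f M x : (forall x, `|f x| <= M) -> `|averages P f x| <= M.
Proof.
move=> fM; rewrite ler_norml -{1}(averages_cst P (- M) x) -{2}(averages_cst P M x).
by rewrite !averages_le// => y; have := fM y; rewrite ler_norml => /andP[].
Qed.

Lemma averages_translate P t f x :
  averages P (fun x => f (t * x)%g) x = averages P f (t * x)%g.
Proof.
elim: P x => //= tn P IH x; rewrite /average; congr (_ * _).
by apply: eq_bigr => i _; rewrite IH !mulgA (mulgC t).
Qed.

(** Translations commute with all the averages, and the average over t itself
    telescopes, leaving only the two boundary terms. *)
Lemma averages_almost_invariant P t n f M x : (forall x, `|f x| <= M) -> (t, n) \in P ->
  `|averages P f (t * x)%g - averages P f x| <= n.+1%:R^-1 * (M + M).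
Proof.
move=> fM; elim: P x => //= sm P IH x; rewrite inE => /orP[/eqP <- /=|tnP].
  rewrite /average -mulrBr normrM ger0_norm ?invr_ge0// ler_wpM2l ?invr_ge0//.
  rewrite -sumrB; under eq_bigr do rewrite mulgA -expgSr.
  rewrite -(big_mkord xpredT (fun i =>
    averages P f (t ^+ i.+1 * x)%g - averages P f (t ^+ i * x)%g)).
  rewrite (telescope_sumr (fun i => averages P f (t ^+ i * x)%g))//.
  by rewrite (le_trans (ler_normB _ _))// lerD ?averages_bound.
rewrite /average -mulrBr -sumrB normrM ger0_norm ?invr_ge0//.
rewrite mulrC ler_pdivrMr ?ltr0n// mulr_natr.
apply: (le_trans (ler_norm_sum _ _ _)).
rewrite -[X in _ *+ X](card_ord sm.2.+1) -sumr_const ler_sum// => i _.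
by rewrite mulgA (mulgC _ t) -mulgA IH.
Qed.

(** Amenability of abelian groups: along an ultrafilter which eventually contains
    each pair (t, n), the defect of t-invariance of the averages is at most
    2 M / n.+1 for every n, where M bounds f. *)
Lemma exists_invariant_mean : inhabited (invariant_mean R G).
Proof.
have [U [UU FU]] := ultraFilterLemma (superset_filter_proper (G * nat)%type).
pose A f P := averages P f 1%g.
have Acvg f : bounded_function f -> cvg (A f @ U).
  move=> [M fM]; apply: (ultra_bounded_cvg (M := M)).
  by apply: filterE => P; exact: averages_bound.
pose m f := lim (A f @ U).
have mcst c : m (fun=> c) = c.
  rewrite /m (_ : A _ = fun=> c); first exact: lim_cst.
  by apply/funext => P; exact: averages_cst.
have madd f g : bounded_function f -> bounded_function g -> m (fun x => f x + g x) = m f + m g.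
  move=> /Acvg fc /Acvg gc; rewrite /m (_ : A _ = A f \+ A g) ?limD//.
  by apply/funext => P; exact: averages_add.
have mscale c f : bounded_function f -> m (fun x => c * f x) = c * m f.
  move=> /Acvg fc; rewrite /m.
  rewrite (_ : A _ = (fun=> c) \* A f); last by apply/funext => P; exact: averages_scale.
  by rewrite limM; [rewrite lim_cst|exact: is_cvg_cst|].
have mge0 f : bounded_function f -> (forall x, 0 <= f x) -> 0 <= m f.
  move=> /Acvg fc f0; apply: limr_ge => //; apply: filterE => P.
  by rewrite -(averages_cst P 0 1%g) averages_le.
exists; exists m => // t f fb; apply/eqP; rewrite -subr_eq0 -normr_eq0.
rewrite eq_le normr_ge0 andbT.
have [M fM] := fb; have ftb : bounded_function (fun x => f (t * x)%g) by exists M.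
rewrite /m -limB; [|exact: Acvg..].
rewrite -lim_norm; last by apply: is_cvgB; exact: Acvg.
apply/ler_addgt0Pr => e e0; rewrite add0r.
have M0 : 0 <= M by apply: le_trans (fM 1%g).
pose n := Num.truncn ((M + M) / e).
apply: limr_le.
  by apply: is_cvg_norm; apply: is_cvgB; exact: Acvg.
have : U [set P : seq (G * nat) | (t, n) \in P] by apply: FU; exact: near_superset_mem.
apply: filterS => P tnP.
have -> : `|(A (fun x => f (t * x)%g) - A f) P| =
    `|averages P (fun x => f (t * x)%g) 1%g - averages P f 1%g| by [].
rewrite averages_translate.
apply: (le_trans (averages_almost_invariant _ fM tnP)).
rewrite mulrC ler_pdivrMr// mulrC -ler_pdivrMr//; apply/ltW; exact: truncnS_gt.
Qed.
End MeanExists.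

(** * Means of continuous functions on compact groups *)

Section MeanTheory.
Variables (R : realType) (G : groupType) (m : invariant_mean R G).
Local Open Scope ring_scope.
Implicit Types f g : G -> R.

Lemma mean_sum (I : Type) (r : seq I) (f : I -> G -> R) :
  (forall i, bounded_function (f i)) ->
  m (fun x => \sum_(i <- r) f i x) = \sum_(i <- r) m (f i).
Proof.
move=> fb; elim: r => [|i r IH].
  by rewrite big_nil -[RHS](mean_cst m); congr (m _); apply/funext => x; rewrite big_nil.
rewrite big_cons -IH -mean_add//; last exact: bounded_sum.
by congr (m _); apply/funext => x; rewrite big_cons.
Qed.

Lemma mean_sub f g : bounded_function f -> bounded_function g ->
  m (fun x => f x - g x) = m f - m g.
Proof.
move=> fb gb; rewrite -[in RHS]mulN1r -mean_scale// -mean_add//.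
  by congr (m _); apply/funext => x; rewrite mulN1r.
by apply: bounded_mul => //; exact: bounded_cst.
Qed.

Lemma mean_le f g : bounded_function f -> bounded_function g ->
  (forall x, f x <= g x) -> m f <= m g.
Proof.
move=> fb gb fg; rewrite -subr_ge0 -mean_sub// mean_ge0//; last by move=> x; rewrite subr_ge0.
have [M fM] := fb; have [N gN] := gb; exists (N + M) => x.
by rewrite (le_trans (ler_normB _ _))// lerD.
Qed.

Lemma mean_norm_le f M : (forall x, `|f x| <= M) -> `|m f| <= M.
Proof.
move=> fM; have fb : bounded_function f by exists M.
rewrite ler_norml -{1}(mean_cst m (- M)) -{2}(mean_cst m M).
by rewrite !mean_le//; try (exact: bounded_cst);
  move=> x; have := fM x; rewrite ler_norml => /andP[].
Qed.

Lemma bounded_mean (f : G -> G -> R) M : (forall x y, `|f x y| <= M) ->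
  bounded_function (fun x => m (f x)).
Proof. by move=> fM; exists M => x; exact: mean_norm_le. Qed.

(** Fubini's theorem for a finitely additive mean fails for general bounded
    functions.  It holds here because f is uniformly close to f (p x) y, which is
    a finite sum of products of a function of x with a function of y. *)
Lemma mean_exchange (f : G -> G -> R) M : (forall x y, `|f x y| <= M) ->
  (forall e, 0 < e -> exists (s : seq G) (p : G -> G), (forall x, p x \in s) /\
     forall x y, `|f x y - f (p x) y| <= e) ->
  m (fun x => m (f x)) = m (fun y => m (f ^~ y)).
Proof.
move=> fM approx; apply/eqP; rewrite -subr_eq0 -normr_eq0 eq_le normr_ge0 andbT.
apply/ler_addgt0Pr => e e0; rewrite add0r.
have e20 : 0 < e / 2 by rewrite divr_gt0.
have [s [p [ps fp]]] := approx _ e20.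
have fb x : bounded_function (f x) by exists M.
have fb' y : bounded_function (f ^~ y) by exists M.
have fpb x : bounded_function (f (p x)) by exists M.
have fpb' y : bounded_function (fun x => f (p x) y) by exists M.
pose u := undup s.
pose ind a (x : G) : R := (p x == a)%:R.
have indb a : bounded_function (ind a).
  by exists 1 => x; rewrite /ind normr_nat; case: (_ == _); rewrite ?ler10 ?lexx.
have indE (h : G -> R) x : h (p x) = \sum_(a <- u) h a * ind a x.
  rewrite (bigD1_seq (p x)) ?undup_uniq ?mem_undup//= /ind eqxx mulr1 big1 ?addr0// => a apx.
  by rewrite eq_sym (negbTE apx) mulr0.
have -> : m (fun x => m (f x)) - m (fun y => m (f ^~ y)) =
    m (fun x => m (f x) - m (f (p x))) -
    m (fun y => m (fun x => f x y) - m (fun x => f (p x) y)).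
  rewrite !mean_sub//; try by apply: bounded_mean => *; exact: fM.
  suff -> : m (fun x => m (f (p x))) = m (fun y => m (fun x => f (p x) y)) by ring.
  transitivity (\sum_(a <- u) m (f a) * m (ind a)).
    under eq_fun do rewrite (indE (fun x => m (f x))).
    rewrite mean_sum => [|a]; last by apply: bounded_mul => //; exact: bounded_cst.
    by apply: eq_bigr => a _; rewrite mean_scale.
  have E y : m (fun x => f (p x) y) = \sum_(a <- u) m (ind a) * f a y.
    under eq_fun do rewrite (indE (f ^~ y)).
    rewrite mean_sum => [|a]; last by apply: bounded_mul => //; exact: bounded_cst.
    by apply: eq_bigr => a _; rewrite mean_scale// mulrC.
  under [in RHS]eq_fun do rewrite E.
  rewrite mean_sum => [|a]; last by apply: bounded_mul => //; exact: bounded_cst.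
  by apply: eq_bigr => a _; rewrite mean_scale// mulrC.
rewrite (le_trans (ler_normB _ _))// [leRHS](splitr e) lerD//.
  by apply: mean_norm_le => x; rewrite -mean_sub// mean_norm_le.
by apply: mean_norm_le => y; rewrite -mean_sub// mean_norm_le.
Qed.

End MeanTheory.

Section CompactFunctions.
Variables (R : realType) (T : topologicalType).
Hypothesis Tcompact : compact [set: T].
Local Open Scope ring_scope.

Lemma continuous_bounded_function (f : T -> R) : continuous f -> bounded_function f.
Proof.
move=> fc; have : compact (f @` setT).
  by apply: continuous_compact => //; exact: continuous_subspaceT.
move=> /compact_bounded[M [_ /(_ (M + 1))]]; rewrite ltrDl ltr01 => /(_ isT) fM.
by exists (M + 1) => x; apply: fM; exists x.
Qed.

(** Uniform continuity in one variable, from compactness in the other. *)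
Lemma continuous_tube (F : T * T -> R) x0 e : continuous F -> 0 < e ->
  \forall x \near x0, forall y, `|F (x, y) - F (x0, y)| <= e.
Proof.
move=> Fc e0.
have /compact_near_coveringP/(_ T (nbhs x0)
  (fun x y => `|F (x, y) - F (x0, y)| <= e)) := Tcompact.
have cov (y : T) : [set: T] y -> \forall y' \near y & x \near x0, `|F (x, y') - F (x0, y')| <= e.
  move=> _.
  have e20 : 0 < e / 2 by rewrite divr_gt0.
  have /cvgrPdist_le/(_ _ e20)[[A B] /= [Ax By] AB] := Fc (x0, y).
  exists (B, A) => // -[y' x] /= [By' Ax'].
  have h1 := AB (x, y') (conj Ax' By').
  have h2 := AB (x0, y') (conj (nbhs_singleton Ax) By').
  rewrite [leRHS]splitr.
  rewrite (_ : F (x, y') - F (x0, y') =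
    (F (x0, y) - F (x0, y')) - (F (x0, y) - F (x, y'))); last by ring.
  by rewrite (le_trans (ler_normB _ _))// lerD.
move=> /(_ _ cov); apply: filterS => x xT y; exact: xT.
Qed.

Lemma continuous_finite_approx (F : T * T -> R) e : continuous F -> 0 < e ->
  exists (s : seq T) (p : T -> T), (forall x, p x \in s) /\
     forall x y, `|F (x, y) - F (p x, y)| <= e.
Proof.
move=> Fc e0.
have [s sV] := compact_finite_cover Tcompact (fun x => continuous_tube x Fc e0).
exists s, (fun x => sval (cid2 (sV x))); split=> [x|x y].
  by case: cid2.
by case: cid2.
Qed.

End CompactFunctions.

Section MeanCompact.
Variables (R : realType) (G : topologicalGroupType) (m : invariant_mean R G).
Hypothesis Gcompact : compact [set: G].
Local Open Scope ring_scope.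

Lemma mean_exchange_continuous (F : G * G -> R) : continuous F ->
  m (fun x => m (fun y => F (x, y))) = m (fun y => m (fun x => F (x, y))).
Proof.
move=> Fc.
have [M FM] : exists M, forall z, `|F z| <= M.
  apply: continuous_bounded_function => //.
  by rewrite -setXTT; exact: compact_setX.
apply: (@mean_exchange _ _ m (fun x y => F (x, y)) M) => // e e0.
exact: (continuous_finite_approx Gcompact Fc e0).
Qed.

(** Finitely many translates of the open set where f exceeds half of a positive
    value cover G, so the sum of the corresponding translates of f is bounded below
    by a positive constant. *)
Lemma mean_gt0 (f : G -> R) : continuous f -> (forall x, 0 <= f x) ->
  (exists x, f x != 0) -> 0 < m f.
Proof.
move=> fc f0 [a fa].
have fb := continuous_bounded_function Gcompact fc.
have {}fa : 0 < f a by rewrite lt_neqAle eq_sym fa f0.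
pose V (x : G) := [set y | f a / 2 < f (a * x^-1 * y)%g].
have nV x : nbhs x (V x).
  apply: open_nbhs_nbhs; split; last first.
    by rewrite /V /= -mulgA mulVg mulg1 ltr_pdivrMr// ltr_pMr// ltr1n.
  have -> : V x = (fun y => f (a * x^-1 * y)%g) @^-1` [set` `]f a / 2, +oo[].
    by apply/seteqP; split=> y; rewrite /V /= in_itv/= andbT.
  apply: open_comp; last exact: interval_open.
  by move=> y _; exact: continuous_translate.
have [s0 s0V] := compact_finite_cover Gcompact nV.
pose s := undup [seq (a * x^-1)%g | x <- s0].
have le_sum x : f a / 2 <= \sum_(t <- s) f (t * x)%g.
  have [b bs Vb] := s0V x.
  have bs' : (a * b^-1)%g \in s by rewrite mem_undup; apply/mapP; exists b.
  rewrite (bigD1_seq (a * b^-1)%g) ?undup_uniq//= (le_trans (ltW Vb))// lerDl sumr_ge0//.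
rewrite lt_neqAle mean_ge0// andbT eq_sym; apply/eqP => mf0.
have : f a / 2 <= m (fun x => \sum_(t <- s) f (t * x)%g).
  rewrite -(mean_cst m (f a / 2)) mean_le//; first exact: bounded_cst.
  by apply: bounded_sum => t; exact: bounded_comp.
rewrite mean_sum => [|t]; last exact: bounded_comp.
rewrite big1 => [|t _]; last by rewrite mean_translate.
by rewrite leNgt divr_gt0.
Qed.

End MeanCompact.

(** * The inner product defined by a mean *)

Section InnerProduct.
Variables (R : realType) (G : topologicalGroupType) (m : invariant_mean R G).
Hypothesis Gcompact : compact [set: G].
Local Open Scope ring_scope.
Implicit Types f g u v w : G -> R.

Let cb f : continuous f -> bounded_function f.
Proof. exact: continuous_bounded_function. Qed.

Definition inner f g : R := m (fun x => f x * g x).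

Lemma innerC f g : inner f g = inner g f.
Proof. by congr (m _); apply/funext => x; rewrite mulrC. Qed.

Lemma inner_scalel c f h : continuous f -> continuous h ->
  inner (fun x => c * f x) h = c * inner f h.
Proof.
move=> fc hc; rewrite -mean_scale; last exact/cb/continuous_mul.
by congr (m _); apply/funext => x; rewrite mulrA.
Qed.

Lemma inner_subl f g h : continuous f -> continuous g -> continuous h ->
  inner (fun x => f x - g x) h = inner f h - inner g h.
Proof.
move=> fc gc hc; rewrite -mean_sub; [|exact/cb/continuous_mul..].
by congr (m _); apply/funext => x; rewrite mulrBl.
Qed.

Lemma inner_lincombl (k : nat) (a : 'I_k -> R) (u : 'I_k -> G -> R) h :
  (forall i, continuous (u i)) -> continuous h ->
  inner (fun x => \sum_i a i * u i x) h = \sum_i a i * inner (u i) h.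
Proof.
move=> uc hc; rewrite /inner; under eq_fun do rewrite mulr_suml.
rewrite mean_sum => [|i]; last first.
  by apply/cb/continuous_mul => //; exact: continuous_scale.
by apply: eq_bigr => i _; exact: inner_scalel.
Qed.

Lemma inner_sub_sub f g : continuous f -> continuous g ->
  inner (fun x => f x - g x) (fun x => f x - g x) = inner f f - 2 * inner f g + inner g g.
Proof.
move=> fc gc; have fgc := continuous_sub fc gc.
rewrite inner_subl// !(innerC _ (fun x => f x - g x)) !inner_subl//.
by rewrite (innerC g f); ring.
Qed.

Lemma inner_ge0 f : continuous f -> 0 <= inner f f.
Proof.
by move=> fc; apply: mean_ge0 => [|x]; [exact/cb/continuous_mul|rewrite -expr2 sqr_ge0].
Qed.

Lemma inner_eq0 f : continuous f -> inner f f = 0 -> forall x, f x = 0.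
Proof.
move=> fc f0 x; apply/eqP/negPn/negP => fx.
suff : 0 < inner f f by rewrite f0 ltxx.
apply: mean_gt0 => //; first exact: continuous_mul.
  by move=> y; rewrite -expr2 sqr_ge0.
by exists x; rewrite mulf_neq0.
Qed.

Lemma inner_CauchySchwarz f g : continuous f -> continuous g ->
  inner f g ^+ 2 <= inner f f * inner g g.
Proof.
move=> fc gc; have [g0|gN0] := eqVneq (inner g g) 0.
  have gE := inner_eq0 gc g0.
  rewrite g0 mulr0 (_ : inner f g = 0) ?expr0n//.
  by rewrite -[RHS](mean_cst m); congr (m _); apply/funext => x; rewrite gE mulr0.
have gp : 0 < inner g g by rewrite lt_neqAle eq_sym gN0 inner_ge0.
(* The projection of f on g minimizes the energy of f - c g. *)
pose c := inner f g / inner g g.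
have := inner_ge0 (continuous_sub fc (continuous_scale (c := c) gc)).
rewrite inner_sub_sub//; last exact: continuous_scale.
rewrite inner_scalel//; last exact: continuous_scale.
rewrite !(innerC _ (fun x => c * g x)) !inner_scalel// (innerC g f) -(pmulr_lge0 _ gp).
suff -> : (inner f f - 2 * (c * inner f g) + c * (c * inner g g)) * inner g g =
   inner f f * inner g g - inner f g ^+ 2 by rewrite subr_ge0.
by rewrite /c; field.
Qed.

Lemma inner_le f g : continuous f -> continuous g ->
  (forall x, `|f x| <= `|g x|) -> inner f f <= inner g g.
Proof.
move=> fc gc fg; apply: mean_le => [||x]; [exact/cb/continuous_mul..|].
rewrite -!expr2 -(real_normK (num_real (f x))) -(real_normK (num_real (g x))).
by rewrite ler_sqr ?nnegrE.
Qed.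

Lemma inner_le_cst f M : continuous f -> 0 <= M -> (forall x, `|f x| <= M) ->
  inner f f <= M ^+ 2.
Proof.
move=> fc M0 fM; rewrite expr2 -(mean_cst m (M * M)); apply: inner_le => //.
  by move=> x; exact: cvg_cst.
by move=> x; rewrite (ger0_norm M0).
Qed.

End InnerProduct.

(** * Convolution operators *)

Section Convolution.
Variables (R : realType) (G : topologicalGroupType) (m : invariant_mean R G).
Hypothesis Gcompact : compact [set: G].
Hypothesis mulgC : forall x y : G, (x * y = y * x)%g.
Variable phi : G -> R.
Hypothesis phi_cts : continuous phi.
Hypothesis phi_even : forall x, phi x^-1%g = phi x.
Local Open Scope ring_scope.
Implicit Types f g u v w : G -> R.

Local Notation inner := (inner m).

Let cb f : continuous f -> bounded_function f.
Proof. exact: continuous_bounded_function. Qed.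

Definition kernel_at (x y : G) : R := phi (x * y^-1)%g.

Lemma kernel_at_cts x : continuous (kernel_at x).
Proof.
move=> y; apply: (continuous_comp (f := fun y => x * y^-1)%g); last exact: phi_cts.
apply: continuous_mulg => z; first exact: cvg_cst.
by apply: (@continuous_invg _ _ id) => ?; exact: cvg_id.
Qed.

Lemma kernel_atC x y : kernel_at x y = kernel_at y x.
Proof. by rewrite /kernel_at -phi_even invgM invgK. Qed.

Lemma kernel_at_cts2 : continuous (fun z : G * G => kernel_at z.1 z.2).
Proof.
move=> z; apply: (continuous_comp (f := fun z : G * G => z.1 * z.2^-1)%g); last exact: phi_cts.
apply: continuous_mulg => {}z; first exact: cvg_fst.
by apply: (@continuous_invg _ _ snd) => {}z; exact: cvg_snd.
Qed.

Definition convolution u (x : G) : R := inner (kernel_at x) u.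
Local Notation T := convolution.

Definition phi_bound : R := sval (cid (cb phi_cts)).

Lemma phi_boundP x : `|phi x| <= phi_bound.
Proof. by rewrite /phi_bound; case: cid. Qed.

Lemma phi_bound_ge0 : 0 <= phi_bound.
Proof. exact: le_trans (phi_boundP 1%g). Qed.

Lemma convolution_bound u x : continuous u -> T u x ^+ 2 <= phi_bound ^+ 2 * inner u u.
Proof.
move=> uc; rewrite /convolution.
apply: (le_trans (inner_CauchySchwarz _ Gcompact (@kernel_at_cts x) uc)).
rewrite ler_wpM2r ?inner_ge0// inner_le_cst//; first exact: kernel_at_cts.
  exact: phi_bound_ge0.
by move=> y; exact: phi_boundP.
Qed.

(** The neighbourhood is the same for all u, and the bound depends on u only
    through its energy.  This is what makes convolution a compact operator. *)
Lemma convolution_equicontinuous x0 e : 0 < e ->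
  \forall x \near x0, forall u, continuous u -> (T u x - T u x0) ^+ 2 <= e ^+ 2 * inner u u.
Proof.
move=> e0; apply: filterS (continuous_tube Gcompact x0 kernel_at_cts2 e0) => x xe u uc.
rewrite /convolution -inner_subl//; try exact: kernel_at_cts.
have kc : continuous (fun y => kernel_at x y - kernel_at x0 y).
  by apply: continuous_sub; exact: kernel_at_cts.
apply: (le_trans (inner_CauchySchwarz _ Gcompact kc uc)).
by rewrite ler_wpM2r ?inner_ge0// inner_le_cst// ltW.
Qed.

Lemma convolution_cts u : continuous u -> continuous (T u).
Proof.
move=> uc x; apply/cvgrPdist_le => e e0.
have N0 : 0 < inner u u + 1 by rewrite ltr_wpDl ?inner_ge0.
pose d := e / Num.sqrt (inner u u + 1).
have d0 : 0 < d by rewrite divr_gt0// sqrtr_gt0.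
apply: filterS (convolution_equicontinuous x d0) => y /(_ u uc) yd.
rewrite distrC -ler_sqr ?nnegrE// ?(ltW e0)// real_normK ?num_real//.
apply: (le_trans yd); rewrite /d expr_div_n sqr_sqrtr ?(ltW N0)//.
rewrite mulrAC ler_pdivrMr// ler_wpM2l ?sqr_ge0// lerDl//.
Qed.

Lemma convolution_scale c u x : continuous u -> T (fun x => c * u x) x = c * T u x.
Proof.
by move=> uc; rewrite /T innerC inner_scalel//; try exact: kernel_at_cts; rewrite innerC.
Qed.

Lemma convolution_sub u v x : continuous u -> continuous v ->
  T (fun x => u x - v x) x = T u x - T v x.
Proof.
move=> uc vc; rewrite /T innerC inner_subl//; try exact: kernel_at_cts.
by rewrite !(innerC _ _ (kernel_at x)).
Qed.

Lemma convolution_lincomb (k : nat) (a : 'I_k -> R) (u : 'I_k -> G -> R) x :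
  (forall i, continuous (u i)) ->
  T (fun x => \sum_i a i * u i x) x = \sum_i a i * T (u i) x.
Proof.
move=> uc; rewrite /T innerC inner_lincombl//; try exact: kernel_at_cts.
by apply: eq_bigr => i _; rewrite innerC.
Qed.

Lemma convolution_translate t u x : continuous u ->
  T (fun x => u (t * x)%g) x = T u (t * x)%g.
Proof.
move=> uc; rewrite /T /inner.
have kuc : continuous (fun y => kernel_at (t * x)%g y * u y).
  by apply: continuous_mul => //; exact: kernel_at_cts.
rewrite -(mean_translate m t (cb kuc)).
congr (m _); apply/funext => y; congr (_ * _); rewrite /kernel_at; congr phi.
by rewrite invgM mulgA [RHS]mulgC !mulgA mulVg mul1g.
Qed.

(** Evenness of the kernel gives the symmetry after exchanging the two means. *)
Lemma convolution_sym u v : continuous u -> continuous v -> inner (T u) v = inner u (T v).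
Proof.
move=> uc vc.
pose F (z : G * G) := kernel_at z.1 z.2 * (v z.1 * u z.2).
have Fc : continuous F.
  apply: continuous_mul; first exact: kernel_at_cts2.
  apply: continuous_mul => z.
    by apply: (continuous_comp (f := fst)); [exact: cvg_fst|exact: vc].
  by apply: (continuous_comp (f := snd)); [exact: cvg_snd|exact: uc].
have := mean_exchange_continuous m Gcompact Fc; rewrite /F /=.
have kuc x : bounded_function (fun y => kernel_at x y * u y).
  by apply/cb/continuous_mul => //; exact: kernel_at_cts.
have kvc y : bounded_function (fun x => kernel_at y x * v x).
  by apply/cb/continuous_mul => //; exact: kernel_at_cts.
have -> : (fun x => m (fun y => kernel_at x y * (v x * u y))) = (fun x => T u x * v x).
  apply/funext => x; rewrite mulrC -mean_scale//.
  by congr (m _); apply/funext => y; ring.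
have -> : (fun y => m (fun x => kernel_at x y * (v x * u y))) = (fun x => u x * T v x).
  apply/funext => y; rewrite -mean_scale//.
  by congr (m _); apply/funext => x; rewrite kernel_atC; ring.
by [].
Qed.

End Convolution.

(** * Existence of an eigenfunction *)

Section Eigenfunction.
Local Open Scope ring_scope.
Variables (R : realType) (G : topologicalGroupType) (m : invariant_mean R G).
Hypothesis Gcompact : compact [set: G].
Variable phi : G -> R.
Hypothesis phi_cts : continuous phi.
Hypothesis phi_even : forall x, phi x^-1%g = phi x.
Hypothesis phi_neq0 : exists x, phi x != 0.
Implicit Types f g u v w : G -> R.

Local Notation inner := (inner m).
Local Notation T := (convolution m phi).
Local Notation M := (phi_bound Gcompact phi_cts).

Let cb f : continuous f -> bounded_function f.
Proof. exact: continuous_bounded_function. Qed.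

Let Tc u : continuous u -> continuous (T u).
Proof. exact: convolution_cts. Qed.

Let energies := [set r | exists u, [/\ continuous u, inner u u <= 1 & r = inner (T u) (T u)]].

(** The square of the operator norm of T for the inner product, and therefore the
    largest eigenvalue of the square of T. *)
Definition top_energy : R := sup energies.
Local Notation mu := top_energy.

Let energies_le u : continuous u -> inner (T u) (T u) <= M ^+ 2 * inner u u.
Proof.
move=> uc; rewrite -(mean_cst m (_ * _)).
apply: mean_le => [||x]; [exact/cb/continuous_mul/Tc/uc/Tc|exact: bounded_cst|].
by rewrite -expr2; exact: convolution_bound.
Qed.

Let has_sup_energies : has_sup energies.
Proof.
split.
  exists (inner (T (fun=> 0)) (T (fun=> 0))), (fun=> 0); split=> //.
    by move=> x; exact: cvg_cst.
  by rewrite /inner mul0r mean_cst.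
exists (M ^+ 2) => _ [u [uc u1 ->]]; apply: (le_trans (energies_le uc)).
by rewrite ler_piMr// sqr_ge0.
Qed.

Lemma energy_le u : continuous u -> inner (T u) (T u) <= mu * inner u u.
Proof.
move=> uc; have [u0|uN0] := eqVneq (inner u u) 0.
  by rewrite (le_trans (energies_le uc))// u0 !mulr0.
have up : 0 < inner u u by rewrite lt_neqAle eq_sym uN0 inner_ge0.
pose c := (Num.sqrt (inner u u))^-1.
have c2 : c * c = (inner u u)^-1 by rewrite -expr2 exprVn sqr_sqrtr// ltW.
have cuc : continuous (fun x => c * u x) by exact: continuous_scale.
have /(sup_upper_bound has_sup_energies) : energies (inner (T u) (T u) / inner u u).
  exists (fun x => c * u x); split => //.
    by rewrite inner_scalel// innerC inner_scalel// mulrA c2 mulVf.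
  have -> : T (fun x => c * u x) = (fun x => c * T u x).
    by apply/funext => x; exact: convolution_scale.
  have cTc : continuous (fun x => c * T u x) by apply: continuous_scale; exact: Tc.
  rewrite inner_scalel//; try exact: Tc.
  by rewrite innerC inner_scalel//; [rewrite mulrA c2 mulrC|exact: Tc..].
by rewrite ler_pdivrMr.
Qed.

(** The value of T phi at 1 is the energy of phi, so T does not vanish. *)
Lemma top_energy_gt0 : 0 < mu.
Proof.
have pp : 0 < inner phi phi.
  apply: mean_gt0 => //; first exact: continuous_mul.
    by move=> x; rewrite -expr2 sqr_ge0.
  by have [x px] := phi_neq0; exists x; rewrite mulf_neq0.
have := energy_le phi_cts; apply: contraTT => /=; rewrite -!leNgt -?ltNge => mu0.
apply: (@le_lt_trans _ _ 0); first by rewrite mulr_le0_ge0// ltW.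
apply: mean_gt0 => //; first by apply: continuous_mul; exact: Tc.
  by move=> x; rewrite -expr2 sqr_ge0.
exists 1%g; suff : 0 < T phi 1%g by move=> /lt0r_neq0 h; rewrite mulf_neq0.
rewrite /convolution (_ : kernel_at phi 1%g = phi)//.
by apply/funext => y; rewrite /kernel_at mul1g phi_even.
Qed.

(** The square of T is used because it is a nonnegative operator: its norm is
    an eigenvalue, whereas only the norm of T or its opposite need be one of T. *)
Definition eigenfunction u := continuous u /\ forall x, T (T u) x = mu * u x.

(** Almost maximizers of the energy of T u are almost eigenfunctions of the square of
    T. *)
Lemma residual_energy u : continuous u -> inner u u <= 1 ->
  inner (fun x => T (T u) x - mu * u x) (fun x => T (T u) x - mu * u x) <=
  mu * (mu - inner (T u) (T u)).
Proof.
move=> uc u1.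
have TTc := Tc (Tc uc); have suc := continuous_scale (c := mu) uc.
rewrite inner_sub_sub// !(innerC _ _ (fun x => mu * u x)) !inner_scalel//.
rewrite (innerC _ u (fun x => mu * u x)) inner_scalel//.
have -> : inner u (T (T u)) = inner (T u) (T u).
  by rewrite innerC (convolution_sym _ Gcompact phi_cts phi_even)//; exact: Tc.
have := energy_le (Tc uc); set A := inner (T (T u)) _; set B := inner (T u) _.
have := top_energy_gt0; nra.
Qed.

(** Take u_n of energy at most 1 such that the energy of T u_n tends to mu.  The
    functions T u_n are bounded and equicontinuous, so they converge uniformly along
    an ultrafilter; the limit is an eigenfunction by [residual_energy]. *)
Lemma exists_eigenfunction : exists2 v, eigenfunction v & exists x, v x != 0.
Proof.
have mu0 := top_energy_gt0.
have seq n : exists u, [/\ continuous u, inner u u <= 1 & mu - n.+1%:R^-1 <= inner (T u) (T u)].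
  have [|_ [u [uc u1 ->]] ue] := @sup_adherent _ energies n.+1%:R^-1 _ has_sup_energies.
    by rewrite invr_gt0.
  by exists u; split => //; exact: ltW.
have [u_ uP] := choice seq.
have [U [UU FU]] := ultraFilterLemma (F := \oo) _.
have uc n : continuous (u_ n) by case: (uP n).
have u1 n : inner (u_ n) (u_ n) <= 1 by case: (uP n).
have Tuc n := Tc (uc n).
have M0 : 0 <= M by exact: phi_bound_ge0.
have Tu_bound n x : `|T (u_ n) x| <= M.
  rewrite -ler_sqr ?nnegrE// real_normK ?num_real//.
  by apply: (le_trans (convolution_bound _ _ phi_cts _ _)) => //; rewrite ler_piMr// sqr_ge0.
have Tu_cvg x : cvg ((fun n => T (u_ n) x) @ U).
  by apply: (ultra_bounded_cvg (M := M)); apply: filterE => n; exact: Tu_bound.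
pose v x := lim ((fun n => T (u_ n) x) @ U).
have equi x0 (e : R) : 0 < e -> \forall x \near x0,
    (forall n, `|T (u_ n) x - T (u_ n) x0| <= e) /\ `|v x - v x0| <= e.
  move=> e0; apply: filterS (convolution_equicontinuous m Gcompact phi_cts x0 e0) => x xe.
  have xe' n : `|T (u_ n) x - T (u_ n) x0| <= e.
    rewrite -ler_sqr ?nnegrE ?(ltW e0)// real_normK ?num_real//.
    by apply: (le_trans (xe _ (uc n))); rewrite ler_piMr// sqr_ge0.
  split => //; rewrite /v -limB// -lim_norm; last exact: is_cvgB.
  by apply: limr_le; [apply: is_cvg_norm; exact: is_cvgB|exact: filterE].
have vc : continuous v.
  move=> x0; apply/cvgrPdist_le => e e0.
  by apply: filterS (equi x0 e e0) => x [_]; rewrite distrC.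
have unif (e : R) : 0 < e -> \forall n \near U, forall x, `|T (u_ n) x - v x| <= e.
  move=> e0; have e30 : 0 < e / 3 by rewrite divr_gt0.
  have /compact_near_coveringP/(_ nat U (fun n x => `|T (u_ n) x - v x| <= e) _) := Gcompact.
  have cov x : [set: G] x -> \forall x' \near x & n \near U, `|T (u_ n) x' - v x'| <= e.
    move=> _; have /cvgrPdist_le/(_ _ e30) near_n := Tu_cvg x.
    exists ([set x' | (forall n, `|T (u_ n) x' - T (u_ n) x| <= e / 3) /\
                      `|v x' - v x| <= e / 3],
            [set n | `|v x - T (u_ n) x| <= e / 3]).
      by split => //=; exact: equi.
    move=> [x' n] /= [[h1 h2] h3].
    rewrite (_ : T (u_ n) x' - v x' = (T (u_ n) x' - T (u_ n) x) -
      (v x - T (u_ n) x) - (v x' - v x)); last by ring.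
    apply: (le_trans (ler_normB _ _)).
    have := ler_normB (T (u_ n) x' - T (u_ n) x) (v x - T (u_ n) x).
    by have := h1 n; lra.
  by move=> /(_ cov); apply: filterS => n h x; exact: h.
have small (e : R) : 0 < e -> \forall n \near U, n.+1%:R^-1 <= e.
  move=> e0; apply: FU; near=> n.
  rewrite /= invf_ple ?posrE//.
  apply: ltW; apply: (lt_trans (truncnS_gt _)); rewrite ltr_nat ltnS.
  by near: n; exact: nbhs_infty_gt.
exists v; first split => // x.
  apply/eqP; rewrite -subr_eq0 -normr_eq0 eq_le normr_ge0 andbT.
  apply/ler_addgt0Pr => e e0; rewrite add0r.
  (* T (T v) - mu v is the sum of T (T w), T r and - mu w, where w := v - T u_n is
     uniformly at most d and the residual r of u_n has energy at most mu * q; the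
     constants d and q make each of the contributions at most e / 3. *)
  have e30 : 0 < e / 3 by rewrite divr_gt0.
  have d0 : 0 < e / 3 / (M ^+ 2 + 1 + mu).
    by rewrite divr_gt0// addr_gt0// ltr_wpDl// sqr_ge0.
  have q0 : 0 < (e / 3) ^+ 2 / (M ^+ 2 * mu + 1).
    by rewrite divr_gt0 ?exprn_gt0// ltr_wpDl// mulr_ge0 ?sqr_ge0// ltW.
  have [n [nv nq]] := filter_ex (filterI (unif _ d0) (small _ q0)).
  move: d0 q0 nv nq; set d := _ / (_ + _ + _); set q := _ / (_ * _ + 1) => d0 q0 nv nq.
  have dE : (M ^+ 2 + 1 + mu) * d = e / 3.
    by rewrite /d mulrC divfK// gt_eqF// addr_gt0// ltr_wpDl// sqr_ge0.
  have qE : (M ^+ 2 * mu + 1) * q = (e / 3) ^+ 2.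
    by rewrite /q mulrC divfK// gt_eqF// ltr_wpDl// mulr_ge0 ?sqr_ge0// ltW.
  clearbody d q.
  pose w y := v y - T (u_ n) y.
  have wc : continuous w by exact: continuous_sub.
  have wd y : `|w y| <= d by rewrite /w distrC.
  pose r y := T (T (u_ n)) y - mu * u_ n y.
  have rc : continuous r.
    by apply: continuous_sub; [exact/Tc/Tc|exact: continuous_scale].
  have rq : inner r r <= mu * q.
    apply: (le_trans (residual_energy (uc n) (u1 n))).
    rewrite ler_pM2l//; apply: (le_trans _ nq).
    by have [_ _] := uP n; rewrite lerBlDr addrC -lerBlDr.
  have Tr : `|T r x| <= e / 3.
    rewrite -ler_sqr ?nnegrE ?(ltW e30)// real_normK ?num_real//.
    apply: (le_trans (convolution_bound _ Gcompact phi_cts _ rc)).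
    rewrite -qE; apply: (@le_trans _ _ (M ^+ 2 * (mu * q))).
      by rewrite ler_wpM2l// sqr_ge0.
    by rewrite mulrDl mul1r mulrA lerDl ltW.
  have TTw : `|T (T w) x| <= M ^+ 2 * d.
    have Md0 : 0 <= M ^+ 2 * d by rewrite mulr_ge0 ?sqr_ge0// ltW.
    rewrite -ler_sqr ?nnegrE// real_normK ?num_real//.
    apply: (le_trans (convolution_bound _ Gcompact phi_cts _ (Tc wc))).
    rewrite (_ : (M ^+ 2 * d) ^+ 2 = M ^+ 2 * (M ^+ 2 * d ^+ 2)); last by ring.
    rewrite ler_wpM2l ?sqr_ge0//.
    apply: (le_trans (energies_le wc)); rewrite ler_wpM2l ?sqr_ge0//.
    by apply: inner_le_cst => //; exact: ltW.
  have -> : T (T v) x - mu * v x = T (T w) x + T r x - mu * w x.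
    have -> : T w = (fun y => T v y - T (T (u_ n)) y).
      by apply/funext => y; rewrite /w convolution_sub.
    rewrite convolution_sub//; [|exact: Tc|exact/Tc/Tc].
    rewrite /r convolution_sub//; [|exact/Tc/Tc|exact: continuous_scale].
    rewrite convolution_scale// /w; ring.
  apply: (le_trans (ler_normB _ _)).
  have := ler_normD (T (T w) x) (T r x).
  have : `|mu * w x| <= mu * d by rewrite normrM gtr0_norm// ler_pM2l.
  by move: dE TTw Tr; rewrite !mulrDl; lra.
(* If v were 0, T u_n would be uniformly small, although its energy tends to mu. *)
apply: contrapT => nv.
have v0 x : v x = 0 by apply/eqP/negPn/negP => vx; apply: nv; exists x.
have e0 : 0 < Num.sqrt (mu / 4) by rewrite sqrtr_gt0 divr_gt0.
have e1 : 0 < mu / 4 by rewrite divr_gt0.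
have [n [nv1 nv2]] : exists n,
    (forall x, `|T (u_ n) x - v x| <= Num.sqrt (mu / 4)) /\ n.+1%:R^-1 <= mu / 4.
  by apply: (@filter_ex _ U); apply: filterI; [exact: unif|exact: small].
have : inner (T (u_ n)) (T (u_ n)) <= mu / 4.
  rewrite -[leRHS]sqr_sqrtr ?(ltW e1)//; apply: inner_le_cst => //.
  by move=> x; have := nv1 x; rewrite v0 subr0.
have [_ _ h1] := uP n => h2; have : mu - mu / 4 <= mu / 4.
  by rewrite (le_trans _ (le_trans h1 h2))// lerB.
by move: (mu) mu0 => c c0; lra.
Unshelve. all: by end_near.
Qed.

End Eigenfunction.

(** * Finite-dimensional eigenspaces and common eigenvectors *)

Section Eigenspace.
Local Open Scope ring_scope.
Variables (R : realType) (G : topologicalGroupType) (m : invariant_mean R G).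
Hypothesis Gcompact : compact [set: G].
Hypothesis mulgC : forall x y : G, (x * y = y * x)%g.
Variable phi : G -> R.
Hypothesis phi_cts : continuous phi.
Hypothesis phi_even : forall x, phi x^-1%g = phi x.
Hypothesis phi_neq0 : exists x, phi x != 0.
Implicit Types f g u v w : G -> R.

Local Notation inner := (inner m).
Local Notation T := (convolution m phi).
Local Notation M := (phi_bound Gcompact phi_cts).
Local Notation mu := (top_energy m phi).
Local Notation eigen := (eigenfunction m phi).

Let cb f : continuous f -> bounded_function f.
Proof. exact: continuous_bounded_function. Qed.

Let Tc u : continuous u -> continuous (T u).
Proof. exact: convolution_cts. Qed.

Let mu0 : 0 < mu := top_energy_gt0 m Gcompact phi_cts phi_even phi_neq0.

Lemma eigenfunction_sub v w : eigen v -> eigen w -> eigen (fun x => v x - w x).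
Proof.
move=> [vc vE] [wc wE]; split=> [|x]; first exact: continuous_sub.
have -> : T (fun x => v x - w x) = (fun x => T v x - T w x).
  by apply/funext => y; exact: convolution_sub.
by rewrite convolution_sub ?vE ?wE ?mulrBr//; exact: Tc.
Qed.

Lemma eigenfunction_lincomb (k : nat) (a : 'I_k -> R) (u : 'I_k -> G -> R) :
  (forall i, eigen (u i)) -> eigen (fun x => \sum_i a i * u i x).
Proof.
move=> ue; have uc i : continuous (u i) by case: (ue i).
split=> [|x]; first exact: continuous_lincomb.
have -> : T (fun x => \sum_i a i * u i x) = (fun x => \sum_i a i * T (u i) x).
  by apply/funext => y; exact: convolution_lincomb.
rewrite convolution_lincomb//; last by move=> i; exact: Tc.
by rewrite mulr_sumr; apply: eq_bigr => i _; rewrite mulrCA; congr (_ * _); case: (ue i).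
Qed.

Lemma eigenfunction_translate t v : eigen v -> eigen (fun x => v (t * x)%g).
Proof.
move=> [vc vE]; split=> [|x]; first exact: continuous_translate.
have -> : T (fun x => v (t * x)%g) = (fun x => T v (t * x)%g).
  by apply/funext => y; exact: convolution_translate.
by rewrite convolution_translate//; exact: Tc.
Qed.

Definition orthonormal (k : nat) (u : 'I_k -> G -> R) :=
  (forall i, continuous (u i)) /\ forall i j, inner (u i) (u j) = (i == j)%:R.

Lemma inner_orthonormal (k : nat) (a : 'I_k -> R) (u : 'I_k -> G -> R) i :
  orthonormal u -> inner (fun x => \sum_j a j * u j x) (u i) = a i.
Proof.
move=> [uc uo]; rewrite inner_lincombl//.
by rewrite (bigD1 i)//= uo eqxx mulr1 big1 ?addr0// => j ji; rewrite uo (negbTE ji) mulr0.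
Qed.

Lemma Bessel_inequality (k : nat) (u : 'I_k -> G -> R) f :
  orthonormal u -> continuous f -> \sum_i inner f (u i) ^+ 2 <= inner f f.
Proof.
move=> uo fc; have [uc _] := uo; rewrite -subr_ge0.
pose p x := \sum_i inner f (u i) * u i x.
have pc : continuous p by exact: continuous_lincomb.
have pf : inner p f = \sum_i inner f (u i) ^+ 2.
  by rewrite inner_lincombl//; apply: eq_bigr => i _; rewrite (innerC _ (u i)) expr2.
have pp : inner p p = \sum_i inner f (u i) ^+ 2.
  rewrite inner_lincombl//; apply: eq_bigr => i _.
  by rewrite (innerC _ (u i)) inner_orthonormal.
have := inner_ge0 m Gcompact (continuous_sub fc pc).
by rewrite inner_sub_sub// (innerC _ f p) pp pf; lra.
Qed.

(** By Bessel's inequality for the kernel centred at x, the sum of the squares of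
    the T (u i) x is at most the square of the bound of phi.  The mean over x of that
    sum is k times mu. *)
Lemma orthonormal_eigenfunctions_le (k : nat) (u : 'I_k -> G -> R) :
  orthonormal u -> (forall i, eigen (u i)) -> k%:R * mu <= M ^+ 2.
Proof.
move=> uo ue; have [uc uE] := uo.
have -> : k%:R * mu = m (fun x => \sum_i T (u i) x * T (u i) x).
  rewrite mean_sum => [|i]; last by apply/cb/continuous_mul; exact: Tc.
  rewrite -[k in LHS]card_ord -sumr_const mulr_suml; apply: eq_bigr => i _.
  have -> : m (fun x => T (u i) x * T (u i) x) = inner (T (u i)) (T (u i)) by [].
  rewrite (convolution_sym _ Gcompact phi_cts phi_even)//; last exact: Tc.
  have -> : T (T (u i)) = (fun x => mu * u i x) by apply/funext; case: (ue i).
  by rewrite innerC inner_scalel// uE eqxx mulr1 mul1r.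
rewrite -(mean_cst m (M ^+ 2)); apply: mean_le; last 1 first.
- move=> x; under eq_bigr do rewrite -expr2.
  have kc := kernel_at_cts phi_cts (x := x).
  apply: (le_trans (Bessel_inequality uo kc)).
  rewrite inner_le_cst//; first exact: phi_bound_ge0.
  by move=> y; exact: (phi_boundP Gcompact phi_cts (x * y^-1)%g).
- by apply: bounded_sum => i; apply/cb/continuous_mul; exact: Tc.
- exact: bounded_cst.
Qed.

(** An orthonormal family of eigenfunctions of maximal length is a basis of the
    eigenspace. *)
Lemma exists_eigenbasis : exists (k : nat) (u : 'I_k -> G -> R),
  [/\ (0 < k)%N, orthonormal u, forall i, eigen (u i) &
      forall w, eigen w -> forall x, w x = \sum_i inner w (u i) * u i x].
Proof.
pose P k := `[< exists u : 'I_k -> G -> R, orthonormal u /\ forall i, eigen (u i) >].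
have P0 : exists k, P k.
  exists 0%N; apply/asboolP; exists (fun _ _ => 0); split; last by case.
  by split; case.
have Pub k : P k -> (k <= Num.truncn (M ^+ 2 / mu))%N.
  move=> /asboolP[u [uo ue]]; have := orthonormal_eigenfunctions_le uo ue.
  rewrite -ler_pdivlMr// => h.
  by rewrite truncn_ge_nat// divr_ge0 ?sqr_ge0// ltW.
have [k /asboolP[u [uo ue]] kmax] := ex_maxnP P0 Pub.
have [uc uE] := uo.
(* Normalizing an eigenfunction orthogonal to u would yield a longer family. *)
have step w : eigen w -> (forall i, inner w (u i) = 0) -> forall x, w x = 0.
  move=> we w0; apply: contrapT => /existsNP[x /eqP wx]; have [wc _] := we.
  have wp : 0 < inner w w.
    rewrite lt_neqAle eq_sym inner_ge0// andbT; apply/eqP => /inner_eq0 h.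
    by move: wx; rewrite h ?eqxx.
  pose c := (Num.sqrt (inner w w))^-1.
  have c2 : c * c = (inner w w)^-1 by rewrite -expr2 exprVn sqr_sqrtr// ltW.
  have cwc : continuous (fun x => c * w x) by exact: continuous_scale.
  pose u' (i : 'I_k.+1) := if unlift ord_max i is Some j then u j else fun x => c * w x.
  suff /kmax : P k.+1 by rewrite ltnn.
  apply/asboolP; exists u'; split; first split.
  - by move=> i; rewrite /u'; case: unlift.
  - move=> i j; rewrite /u'; case: unliftP => [i'|] ->; case: unliftP => [j'|] ->.
    + by rewrite uE (inj_eq lift_inj).
    + by rewrite innerC inner_scalel// w0 mulr0 eq_sym (negbTE (neq_lift _ _)).
    + by rewrite inner_scalel// w0 mulr0 (negbTE (neq_lift _ _)).
    + by rewrite inner_scalel// innerC inner_scalel// mulrA c2 mulVf ?eqxx//; exact: lt0r_neq0.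
  - move=> i; rewrite /u'; case: unlift => // {i}.
    have := @eigenfunction_lincomb 1 (fun=> c) (fun=> w) (fun=> we).
    by under eq_fun do rewrite big_ord1.
exists k, u; split => //.
  rewrite lt0n; apply/negP => /eqP k0.
  have [v ve [x vx]] := exists_eigenfunction m Gcompact phi_cts phi_even phi_neq0.
  by move: vx; rewrite step ?eqxx// => i; have := ltn_ord i; rewrite {2}k0.
move=> w we x; apply/eqP; rewrite -subr_eq0; apply/eqP.
have [wc _] := we.
have pe := eigenfunction_lincomb (fun i => inner w (u i)) ue.
have [pc _] := pe.
apply: (step (fun x => w x - \sum_i inner w (u i) * u i x)).
  exact: eigenfunction_sub.
by move=> i; rewrite inner_subl// inner_orthonormal// subrr.
Qed.

End Eigenspace.

(** A nonzero subspace of minimal rank stable under all A i is contained in an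
    eigenspace of each of them: the intersection with an eigenspace is again stable
    by commutativity. *)
Lemma common_eigenvector_family (C : numClosedFieldType) (n : nat) (I : Type)
    (A : I -> 'M[C]_n) :
  (0 < n)%N -> (forall i j, A i *m A j = A j *m A i)%R ->
  exists2 v : 'rV[C]_n, (v != 0)%R & forall i, exists c, (v *m A i = c *: v)%R.
Proof.
move=> n0 Acomm.
pose P r := `[< exists V : 'M[C]_n,
  [/\ (\rank V = r)%N, (0 < r)%N & forall i, stablemx V (A i)] >].
have [|r /asboolP[V [rV r0 Vst]] rmin] := @ex_minnP P.
  exists n; apply/asboolP; exists 1%:M%R; split => // [|i]; first exact: mxrank1.
  exact: submx1.
have Vn0 : (V != 0)%R by rewrite -mxrank_eq0 rV -lt0n.
have /rowV0Pn[v vV vn0] := Vn0.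
exists v => // i.
have [a] : exists a, (V :&: eigenspace (A i) a)%MS != 0%R.
  have rV0 : (0 < \rank V)%N by rewrite rV.
  have [b /eigenvalueP[w wE wn0]] := eigenvalue_closed (conjmx (row_base V) (A i)) rV0.
  have : stablemx w (conjmx (row_base V) (A i)) by apply/sub_rVP; exists b.
  rewrite stablemx_restrict// => /eigenvectorP[a wa]; exists a; apply/rowV0Pn.
  exists (w *m row_base V)%R; last by rewrite mulmx_free_eq0 ?row_base_free.
  by rewrite sub_capmx wa andbT mulmx_sub// eq_row_base.
move=> Wn0; exists a; apply/eigenspaceP.
have st j : stablemx (V :&: eigenspace (A i) a)%MS (A j).
  rewrite sub_capmx (submx_trans (submxMr _ (capmxSl _ _)) (Vst j))/=.
  apply: (submx_trans (submxMr _ (capmxSr _ _))).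
  by apply: comm_mx_stable_eigenspace; exact: Acomm.
have rW : (r <= \rank (V :&: eigenspace (A i) a))%N.
  apply: rmin; apply/asboolP; exists (V :&: eigenspace (A i) a)%MS; split => //.
  by rewrite lt0n mxrank_eq0.
have VW : (V <= V :&: eigenspace (A i) a)%MS.
  by rewrite -(mxrank_leqif_sup (capmxSl _ _)) eqn_leq mxrankS ?capmxSl//= rV.
by rewrite (submx_trans vV)// (submx_trans VW)// capmxSr.
Qed.

(** * Continuous maps into the circle *)

Section ComplexFunctions.
Local Open Scope ring_scope.
Local Open Scope complex_scope.
Variable R : realType.
Local Notation Cx := (R[i] : numClosedFieldType).

Lemma normc_le (p q : R) : normc (p +i* q) <= `|p| + `|q|.
Proof.
rewrite /normc -ler_sqr ?nnegrE ?sqrtr_ge0 ?addr_ge0//.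
rewrite sqr_sqrtr ?addr_ge0 ?sqr_ge0// sqrrD !real_normK ?num_real//.
by rewrite lerD2r lerDl mulrn_wge0 ?mulr_ge0.
Qed.

Lemma continuous_complex (T : topologicalType) (f g : T -> R) :
  continuous f -> continuous g -> continuous (fun x => (f x +i* g x : Cx)).
Proof.
move=> fc gc x; apply/cvgrPdist_le => e e0.
have e_real : e = (complex.Re e)%:C by rewrite RRe_real// gtr0_real.
have e20 : 0 < complex.Re e / 2 by rewrite divr_gt0//; move: e0; rewrite {1}e_real ltcR.
have /cvgrPdist_le/(_ _ e20) fx := fc x; have /cvgrPdist_le/(_ _ e20) gx := gc x.
apply: filterS2 fx gx => y fy gy.
rewrite e_real (_ : _ - _ = (f x - f y) +i* (g x - g y))//.
rewrite [X in X <= _](_ : _ = (normc ((f x - f y) +i* (g x - g y)))%:C)//.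
by rewrite lecR (le_trans (normc_le _ _))// [leRHS]splitr lerD.
Qed.

Definition circle_point (p q : R) (pq : p ^+ 2 + q ^+ 2 = 1) : circle_group R.
Proof.
apply: (SigSub (x := p +i* q)); apply/mem_set => /=.
by rewrite normc_def /= pq sqrtr1.
Defined.

Lemma continuous_to_circle (T : topologicalType) (f : T -> circle_group R) :
  continuous (fun x => (set_val (f x) : Cx)) -> continuous f.
Proof. exact: continuous_comp_initial. Qed.

End ComplexFunctions.

(** * A kernel annihilating the functions invariant under a given element *)

Section EvenBump.
Local Open Scope ring_scope.
Variables (R : realType) (G : topologicalGroupType).

Lemma exists_even_separating_function (g : G) : compact_group G -> g <> 1%g ->
  exists k : G -> R, [/\ continuous k, forall x, k x^-1%g = k x & k 1%g != k g].
Proof.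
move=> [Gc Gh] g1.
have Gn := compact_normal Gh Gc.
have cl1 x : closed [set x : G] := accessible_closed_set1 (hausdorff_accessible Gh) (x := x).
have /(@normal_separatorP R) /(_ _ _ (cl1 1%g) (cl1 g)) := Gn.
have -> : [set 1%g] `&` [set g] = set0 by apply/seteqP; split => // x [/= -> /esym].
move=> /(_ erefl) /(@uniform_separatorP _ R)[f [fc f01 f0 f1]].
exists (fun x => f x + f x^-1%g); split.
- apply: continuous_add => // x.
  by apply: (continuous_comp (f := fun x => x^-1%g)); [exact: invg_continuous|exact: fc].
- by move=> x; rewrite invgK addrC.
- have -> : f 1%g = 0 by apply: f0; exists 1%g.
  rewrite invg1 (_ : f 1%g = 0); last by apply: f0; exists 1%g.
  rewrite (_ : f g = 1); last by apply: f1; exists g.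
  have : f g^-1%g \in `[0, 1] by apply: f01; exists g^-1%g.
  rewrite in_itv/= => /andP[h _].
  by rewrite addr0 eq_sym gt_eqF// ltr_pwDl.
Qed.

End EvenBump.

Section SecondDifference.
Local Open Scope ring_scope.
Variables (R : realType) (G : topologicalGroupType) (m : invariant_mean R G).
Hypothesis Gcompact : compact [set: G].
Hypothesis mulgC : forall x y : G, (x * y = y * x)%g.
Variables (k : G -> R) (g : G).
Hypothesis k_cts : continuous k.
Hypothesis k_even : forall x, k x^-1%g = k x.

(** If L is the translation by g, then the convolution by this kernel is the
    convolution by k composed with (1 - L) (1 - L^-1), which kills the functions
    invariant under g. *)
Definition second_difference (x : G) : R := 2 * k x - k (g * x)%g - k (g^-1 * x)%g.
Local Notation phi := second_difference.

Lemma second_difference_cts : continuous phi.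
Proof.
apply: continuous_sub; last exact: continuous_translate.
by apply: continuous_sub; [exact: continuous_scale|exact: continuous_translate].
Qed.

Lemma second_difference_even x : phi x^-1%g = phi x.
Proof.
rewrite /phi k_even -(k_even (g * x^-1)%g) -(k_even (g^-1 * x^-1)%g) !invgM !invgK.
by rewrite !(mulgC x); ring.
Qed.

Lemma second_difference1 : phi 1%g = 2 * (k 1%g - k g).
Proof. by rewrite /phi !mulg1 k_even; ring. Qed.

(** For invariant u, translating the variable of the mean by g or by g^-1 turns each
    of the two translated terms into the untranslated one. *)
Lemma convolution_second_difference_invariant (u : G -> R) x :
  continuous u -> (forall y, u (g * y)%g = u y) -> convolution m phi u x = 0.
Proof.
move=> uc ug.
have bd (f : G -> R) : continuous f -> bounded_function f by exact: continuous_bounded_function.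
have kc t : continuous (fun y => k (t * (x * y^-1))%g * u y).
  apply: continuous_mul => // y.
  apply: (continuous_comp (f := fun y => (t * (x * y^-1))%g)); last exact: k_cts.
  apply: continuous_mulg => z; first exact: cvg_cst.
  apply: continuous_mulg => {}z; first exact: cvg_cst.
  by apply: (@continuous_invg _ _ id) => ?; exact: cvg_id.
have ug' y : u (g^-1 * y)%g = u y by rewrite -[in RHS](mulVKg g y) ug.
rewrite /convolution /inner /kernel_at.
have -> : (fun y => phi (x * y^-1)%g * u y) = (fun y => 2 * (k (1 * (x * y^-1))%g * u y) -
    k (g * (x * y^-1))%g * u y - k (g^-1 * (x * y^-1))%g * u y).
  by apply/funext => y; rewrite /phi mul1g; ring.
have kc1 := continuous_scale (c := 2) (kc 1%g).
rewrite !mean_sub//; try exact: bd; last exact/bd/continuous_sub.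
rewrite mean_scale; last exact: bd.
have E t : (forall y, u (t * y)%g = u y) ->
    m (fun y => k (t * (x * y^-1))%g * u y) = m (fun y => k (1 * (x * y^-1))%g * u y).
  move=> ut; rewrite -(mean_translate m t (bd _ (kc t))).
  congr (m _); apply/funext => y; rewrite ut; congr (k _ * _).
  by rewrite mul1g invgM mulgC -!mulgA mulVg mulg1.
by rewrite (E g)// (E g^-1%g)//; ring.
Qed.

End SecondDifference.

(** * Characters of compact abelian groups *)

(** The supremum S of rho satisfies rho x * S <= S, so rho <= 1 everywhere; apply
    this to x and to its inverse. *)
Lemma bounded_multiplicative_eq1 (R : realType) (G : groupType) (rho : G -> R) :
  bounded_function rho -> (forall x, 0 <= rho x)%R -> rho 1%g = 1%R ->
  (forall x y, rho (x * y)%g = rho x * rho y)%R -> forall x, rho x = 1%R.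
Proof.
move=> [B rhoB] rho0 rho1 rhoM.
have hs : has_sup (range rho).
  split; first by exists (rho 1%g), 1%g.
  by exists B => _ [x _ <-]; exact: le_trans (ler_norm _) (rhoB x).
pose S := sup (range rho).
have leS x : (rho x <= S)%R by apply: sup_upper_bound => //; exists x.
have S0 : (0 < S)%R by rewrite (lt_le_trans ltr01)// -rho1.
have rho_le1 x : (rho x <= 1)%R.
  rewrite leNgt; apply/negP => x1.
  have x0 : (0 < rho x)%R by apply: lt_trans x1.
  have : (S <= S / rho x)%R.
    apply: ge_sup; first by exists (rho 1%g), 1%g.
    by move=> _ [y _ <-]; rewrite ler_pdivlMr// mulrC -rhoM.
  by rewrite ler_pdivlMr// ger_pMr// leNgt x1.
move=> x; apply/eqP; rewrite eq_le rho_le1/= -rho1 -(mulgV x) rhoM.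
by rewrite ler_piMr.
Qed.

Section Characters.
Local Open Scope ring_scope.
Local Open Scope complex_scope.
Variables (R : realType) (G : topologicalGroupType).
Hypothesis Gcompact : compact_group G.
Hypothesis Gabelian : abelian_group G.
Local Notation Cx := (R[i] : numClosedFieldType).

(** The commuting matrices A t of the translations on the eigenspace of the
    convolution by the second difference of k have a common left eigenvector v.
    The function w := a + i b is the corresponding combination of the basis, and the
    character is its eigenvalue c. *)
Lemma exists_character (g : G) : g <> 1%g ->
  exists2 chi : G -> circle_group R, continuous_hom chi & chi g <> 1%g.
Proof.
move=> g1; have [Gc Gh] := Gcompact.
have [m] := @exists_invariant_mean R G Gabelian.
have [k [kc ke k1g]] := exists_even_separating_function R Gcompact g1.
pose phi := second_difference k g.
have phic : continuous phi by exact: second_difference_cts.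
have phie x : phi x^-1%g = phi x by exact: second_difference_even.
have phi0 : exists x, phi x != 0.
  by exists 1%g; rewrite /phi second_difference1// mulf_neq0// subr_eq0.
have mu0 := top_energy_gt0 m Gc phic phie phi0.
have [n [u [n0 uo ue basis_u]]] := exists_eigenbasis m Gc phic phie phi0.
have [uc _] := uo.
pose A t : 'M[R]_n := \matrix_(i, j) inner m (fun x => u i (t * x)%g) (u j).
have uA t i x : u i (t * x)%g = \sum_j A t i j * u j x.
  have /basis_u -> := eigenfunction_translate Gc Gabelian phic t (ue i).
  by apply: eq_bigr => j _; rewrite mxE.
have AM s t : A s *m A t = A (s * t)%g.
  apply/matrixP => i j; rewrite mxE.
  rewrite -(inner_orthonormal Gc (fun j => \sum_l A s i l * A t l j) j uo).
  rewrite [RHS]mxE; congr (inner m _ _); apply/funext => x.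
  rewrite -mulgA uA; under [RHS]eq_bigr do rewrite uA mulr_sumr.
  rewrite exchange_big/=; apply: eq_bigr => l _.
  by rewrite mulr_suml; apply: eq_bigr => l' _; rewrite mulrA.
pose AC t : 'M[Cx]_n := map_mx (real_complex R) (A t).
have [s t|v v0 vA] := common_eigenvector_family (A := AC) n0.
  by rewrite -!map_mxM !AM Gabelian.
have [c cE] := choice vA.
pose a x := \sum_i complex.Re (v ord0 i) * u i x.
pose b x := \sum_i complex.Im (v ord0 i) * u i x.
have ac : continuous a by exact: continuous_lincomb.
have bc : continuous b by exact: continuous_lincomb.
pose w x : Cx := a x +i* b x.
have wE x : w x = \sum_i v ord0 i * (u i x)%:C.
  apply/eqP; rewrite eq_complex /= /a /b !raddf_sum; apply/andP; split.
    by apply/eqP/eq_bigr => i _; case: (v _ _) => p q /=; ring.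
  by apply/eqP/eq_bigr => i _; case: (v _ _) => p q /=; ring.
have wc t x : w (t * x)%g = c t * w x.
  rewrite !wE mulr_sumr.
  have E j : c t * (v ord0 j * (u j x)%:C) = \sum_i v ord0 i * ((A t i j)%:C * (u j x)%:C).
    rewrite mulrA; have := congr1 (fun B : 'rV_n => B ord0 j) (cE t).
    rewrite !mxE => <-; rewrite mulr_suml; apply: eq_bigr => i _.
    by rewrite mxE mulrA.
  under [RHS]eq_bigr do rewrite E.
  rewrite exchange_big/=; apply: eq_bigr => i _.
  rewrite -mulr_sumr uA rmorph_sum; congr (_ * _).
  by apply: eq_bigr => j _; rewrite rmorphM.
(* If w 1 = 0, then w vanishes identically, and so do the coordinates of v. *)
have w1 : w 1%g != 0.
  apply/eqP => w10.
  have w_eq0 x : w x = 0 by rewrite -(mulg1 x) wc w10 mulr0.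
  have [a0 b0] : a = (fun=> 0) /\ b = (fun=> 0).
    by split; apply/funext => x; move: (w_eq0 x) => [].
  move: v0; apply/negP/negPn/eqP/rowP => i; rewrite mxE.
  apply/eqP; rewrite eq_complex /=.
  rewrite -(inner_orthonormal Gc (fun i => complex.Re (v ord0 i)) i uo).
  rewrite -(inner_orthonormal Gc (fun i => complex.Im (v ord0 i)) i uo).
  rewrite -/a -/b a0 b0 /inner.
  by under eq_fun do rewrite mul0r; rewrite mean_cst eqxx.
have cw t : c t = w t / w 1%g by rewrite -[in RHS](mulg1 t) wc mulfK.
have cM s t : c (s * t)%g = c s * c t by rewrite cw wc -mulrA -cw.
have c1 : c 1%g = 1 by rewrite cw divff.
have rho_bd : bounded_function (fun t => normc (c t)).
  have [Ma aM] := continuous_bounded_function Gc ac.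
  have [Mb bM] := continuous_bounded_function Gc bc.
  exists ((Ma + Mb) * normc (w 1%g)^-1) => t.
  rewrite cw normcM normrM [X in _ * X]ger0_norm; last by case: (_^-1) => *; exact: sqrtr_ge0.
  rewrite ler_wpM2r//; first by case: (_^-1) => *; exact: sqrtr_ge0.
  rewrite ger0_norm; last exact: sqrtr_ge0.
  by rewrite (le_trans (normc_le _ _))// lerD.
have c_norm t : normc (c t) = 1.
  apply: (bounded_multiplicative_eq1 (rho := fun t => normc (c t))) => //.
  - by move=> x; case: (c x) => *; exact: sqrtr_ge0.
  - by rewrite c1 normc1.
  - by move=> x y; rewrite cM normcM.
have c_norm' t : `|c t| = 1 by rewrite -[LHS]/((normc (c t))%:C) c_norm.
pose chi t : circle_group R := SigSub (x := (c t : Cx)) (mem_set (c_norm' t)).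
exists chi.
  split; last by move=> s t; apply: val_inj; exact: cM.
  apply: continuous_to_circle => t.
  have -> : (fun x => set_val (chi x) : Cx) = (fun x => w x / w 1%g).
    by apply/funext => x; rewrite -cw.
  apply: cvgM; last exact: cvg_cst.
  exact: (continuous_complex ac bc).
move=> chig; have cg1 : c g = 1 := congr1 val chig.
have wg x : w (g * x)%g = w x by rewrite wc cg1 mul1r.
(* Apply to the real and imaginary parts of w, which are eigenfunctions. *)
have vanish (h : G -> R) : eigenfunction m phi h ->
    (forall x, h (g * x)%g = h x) -> h 1%g = 0.
  move=> [hc hE] hg; apply/eqP.
  have Th0 : convolution m phi h = fun=> 0.
    apply/funext => x; exact: convolution_second_difference_invariant.
  have := hE 1%g; rewrite Th0 => /esym/eqP.
  rewrite /convolution /inner; under eq_fun do rewrite mulr0.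
  by rewrite mean_cst mulf_eq0 gt_eqF.
have ea : eigenfunction m phi a by exact: eigenfunction_lincomb.
have eb : eigenfunction m phi b by exact: eigenfunction_lincomb.
move: w1; rewrite /w !vanish ?eqxx//.
- by move=> x; case: (wg x).
- by move=> x; case: (wg x).
Qed.

End Characters.

(** * Closed subgroups of the circle *)

Lemma continuous_cluster (X Y : topologicalType) (f : X -> Y) (x x' : X) :
  continuous f -> cluster (nbhs x) x' -> cluster (nbhs (f x)) (f x').
Proof.
move=> fc xx' A B nA nB; have [z [zA zB]] := xx' _ _ (fc x A nA) (fc x' B nB).
by exists (f z).
Qed.

Section CircleSubgroups.
Local Open Scope ring_scope.
Local Open Scope complex_scope.
Variable R : realType.
Local Notation circle := (circle_group R).

Definition circle_exp (t : R) : circle := circle_point (cos2Dsin2 t).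

Lemma circle_exp_continuous : continuous circle_exp.
Proof.
apply: continuous_to_circle.
exact: (continuous_complex (@continuous_cos R) (@continuous_sin R)).
Qed.

Lemma circle_expD s t : circle_exp (s + t) = (circle_exp s * circle_exp t)%g.
Proof. by apply: val_inj; rewrite /= cosD sinD (addrC (sin s * _)). Qed.

Lemma circle_exp0 : circle_exp 0 = 1%g.
Proof. by apply: val_inj; rewrite /= cos0 sin0. Qed.

Lemma circle_expN t : circle_exp (- t) = (circle_exp t)^-1%g.
Proof. by apply: (mulgI (circle_exp t)); rewrite mulgV -circle_expD subrr circle_exp0. Qed.

Lemma circle_exp_surj (z : circle) : exists2 t, - pi <= t <= pi & circle_exp t = z.
Proof.
case: z => -[p q] zP; have := set_mem zP.
rewrite /= normc_def => -[/eqP]; rewrite /= -(sqrtr1 R) eqr_sqrt ?addr_ge0 ?sqr_ge0// => /eqP pq.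
have p1 : -1 <= p <= 1.
  rewrite -ler_norml -(ler_sqr (x := `|p|)) ?nnegrE// real_normK ?num_real//.
  by rewrite expr1n -pq lerDl sqr_ge0.
have qE : Num.sqrt (1 - p ^+ 2) = `|q| by rewrite -pq addrAC subrr add0r sqrtr_sqr.
have /andP[a0 api] : 0 <= acos p <= pi by rewrite acos_ge0 ?acos_lepi.
have [q0|q0] := leP 0 q.
  exists (acos p); first by rewrite api andbT (le_trans _ a0)// oppr_le0 pi_ge0.
  by apply: val_inj; rewrite /= acosK// sin_acos// qE ger0_norm.
exists (- acos p); first by rewrite lerN2 api (le_trans _ (pi_ge0 R))// oppr_le0.
by apply: val_inj; rewrite /= cosN sinN acosK// sin_acos// qE ltr0_norm// opprK.
Qed.

(** An infinite subgroup contains exp(i h) for arbitrarily small h > 0, by the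
    pigeonhole principle on angles; the multiples of h are then h-dense. *)
Lemma circle_closed_subgroup (K : set circle) :
  closed K -> K 1%g -> (forall x y, K x -> K y -> K (x * y)%g) ->
  (forall x, K x -> K x^-1%g) -> ~ finite_set K -> K = setT.
Proof.
move=> Kcl K1 KM KV Kinf.
pose A := [set t | - pi <= t <= pi /\ K (circle_exp t)].
have Ainf : ~ finite_set A.
  move=> /(finite_image circle_exp); apply: contra_not Kinf; apply: sub_finite_set => z Kz.
  by have [t tpi tz] := circle_exp_surj z; exists t => //; split => //; rewrite tz.
have small d : 0 < d -> exists2 h, 0 < h < d & K (circle_exp h).
  (* f t is the number of the interval of length d containing t. *)
  move=> d0; pose f t := Num.truncn ((t + pi) / d).
  have [s [t [[spi Ks] [tpi Kt] st fst]]] : exists s t, [/\ A s, A t, s < t & f s = f t].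
    apply: contrapT => ninj; apply: Ainf.
    have fi : {in A &, injective f}.
      move=> s t /set_mem As /set_mem At fst; apply/eqP/negPn/negP => nst.
      apply: ninj; have [st|ts|/eqP] := ltgtP s t; [by exists s, t|by exists t, s|].
      by rewrite (negbTE nst).
    rewrite -(eq_finite_set (inj_card_eq fi)).
    apply: (@sub_finite_set _ _ `I_(f pi).+1); last exact: finite_II.
    move=> _ [t [/andP[_ tpi] _] <-] /=; rewrite ltnS /f.
    by apply: le_truncn; rewrite ler_pM2r ?invr_gt0// lerD2r.
  exists (t - s); last by rewrite circle_expD circle_expN; apply: KM => //; exact: KV.
  have pos r : - pi <= r <= pi -> 0 <= (r + pi) / d.
    by move=> /andP[rpi _]; rewrite divr_ge0 ?(ltW d0)// -lerBlDr sub0r.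
  rewrite subr_gt0 st /=.
  have /andP[_ t1] := truncn_itv (pos t tpi).
  have /andP[s1 _] := truncn_itv (pos s spi).
  rewrite -/(f t) -fst in t1; rewrite -/(f s) in s1.
  move: t1 s1; rewrite ltr_pdivrMr// ler_pdivlMr// -natr1 mulrDl mul1r; lra.
have Kpow h n : K (circle_exp h) -> K (circle_exp (n%:R * h)).
  move=> Kh; elim: n => [|n IH]; first by rewrite mul0r circle_exp0.
  by rewrite -natr1 mulrDl mul1r circle_expD; exact: KM.
have Kexp t : 0 <= t -> K (circle_exp t).
  move=> t0; have : closed (circle_exp @^-1` K).
    by apply: closed_comp => // x _; exact: circle_exp_continuous.
  apply => B /nbhs_ballP[d /= d0 dB].
  have [h /andP[h0 hd] Kh] := small d d0.
  exists ((Num.truncn (t / h))%:R * h); split; first exact: Kpow.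
  apply: dB; rewrite /ball /=.
  have /andP[] := truncn_itv (divr_ge0 t0 (ltW h0)).
  rewrite ltr_pdivrMr// ler_pdivlMr// -natr1 mulrDl mul1r => h1 h2.
  by rewrite ger0_norm ?subr_ge0//; lra.
apply/seteqP; split => // z _.
have [t _ <-] := circle_exp_surj z; have [t0|t0] := leP 0 t; first exact: Kexp.
by rewrite -(opprK t) circle_expN; apply/KV/Kexp; rewrite oppr_ge0 ltW.
Qed.

Lemma circle_hausdorff : hausdorff_space circle.
Proof.
move=> x y xy; apply: val_inj.
apply: (@norm_hausdorff _ (R[i] : numClosedFieldType)).
exact: (continuous_cluster (@initial_continuous _ _
  (@set_val _ [set z : (R[i] : numClosedFieldType) | `|z| = 1])) xy).
Qed.

End CircleSubgroups.

(** * Quotients of abelian topological groups *)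

Section Quotient.
Local Open Scope group_scope.
Local Open Scope quotient_scope.
Variables (G : topologicalGroupType) (N : set G).
Hypothesis Gabelian : abelian_group G.

Definition subgroup_set := N 1 /\ forall x y, N x -> N y -> N (x * y^-1).
Hypothesis Nsub : subgroup_set.

Let coset_rel : rel G := fun x y => `[< N (x * y^-1) >].

Let N1 : N 1. Proof. by case: Nsub. Qed.
Let NV x : N x -> N x^-1.
Proof. by move=> Nx; rewrite -[x^-1]mul1g; case: Nsub => _; apply. Qed.
Let NM x y : N x -> N y -> N (x * y).
Proof. by move=> Nx /NV Ny; rewrite -[y]invgK; case: Nsub => _; apply. Qed.

Let coset_equiv : equiv_class_of coset_rel.
Proof.
split=> [x|x y|y x z].
- by apply/asboolP; rewrite mulgV.
- by apply/asboolP/asboolP => /NV; rewrite invgM invgK.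
- move=> /asboolP xy /asboolP yz; apply/asboolP.
  by have := NM xy yz; rewrite mulgA mulgVK.
Qed.

Canonical coset_equivalence := EquivRelPack coset_equiv.

(** Commutativity is a parameter so that the group structure below can be inferred
    from the type alone. *)
Definition quotient_group of abelian_group G : Type :=
  quotient_topology {eq_quot coset_equivalence}.
Local Notation Q := (quotient_group Gabelian).

HB.instance Definition _ := Topological.on Q.

Definition quotient_proj (x : G) : Q := \pi_{eq_quot coset_equivalence} x.
Local Notation q := quotient_proj.

Lemma quotient_projP x y : q x = q y <-> N (x * y^-1).
Proof. by split=> [/eqmodP/asboolP|Nxy]; [|apply/eqmodP/asboolP]. Qed.

Lemma quotient_proj_surj (z : Q) : exists x, q x = z.
Proof. by exists (repr z); rewrite /q reprK. Qed.

Let quot_repr (z : Q) : G := sval (cid (quotient_proj_surj z)).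
Let quot_reprK z : q (quot_repr z) = z.
Proof. by rewrite /quot_repr; case: cid. Qed.

Definition quotient_one : Q := q 1.
Definition quotient_mul (x y : Q) : Q := q (quot_repr x * quot_repr y).
Definition quotient_inv (x : Q) : Q := q (quot_repr x)^-1.

Lemma quotient_mulE x y : quotient_mul (q x) (q y) = q (x * y).
Proof.
apply/quotient_projP.
have /quotient_projP h1 := quot_reprK (q x); have /quotient_projP h2 := quot_reprK (q y).
have := NM h1 h2; set a := quot_repr _; set b := quot_repr _.
by rewrite invgM -!mulgA [x^-1 * _]Gabelian [b * _ in X in _ -> X]mulgA.
Qed.

Lemma quotient_invE x : quotient_inv (q x) = q x^-1.
Proof.
apply/quotient_projP; have /quotient_projP := quot_reprK (q x).
by move=> /NV; rewrite invgM invgK Gabelian.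
Qed.

Let mulA : associative quotient_mul.
Proof.
move=> x y z; have [a <-] := quotient_proj_surj x; have [b <-] := quotient_proj_surj y.
by have [c <-] := quotient_proj_surj z; rewrite !quotient_mulE mulgA.
Qed.

Let mul1 : left_id quotient_one quotient_mul.
Proof. by move=> x; have [a <-] := quotient_proj_surj x; rewrite quotient_mulE mul1g. Qed.

Let mulx1 : right_id quotient_one quotient_mul.
Proof. by move=> x; have [a <-] := quotient_proj_surj x; rewrite quotient_mulE mulg1. Qed.

Let mulV : left_inverse quotient_one quotient_inv quotient_mul.
Proof.
move=> x; have [a <-] := quotient_proj_surj x.
by rewrite quotient_invE quotient_mulE mulVg.
Qed.

Let mulxV : right_inverse quotient_one quotient_inv quotient_mul.
Proof.
move=> x; have [a <-] := quotient_proj_surj x.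
by rewrite quotient_invE quotient_mulE mulgV.
Qed.

HB.instance Definition _ := isGroup.Build Q mulA mul1 mulx1 mulV mulxV.

Lemma quotient_proj_continuous : continuous q.
Proof. exact: pi_continuous. Qed.

Lemma quotient_open_preimage (A : set Q) : open (q @^-1` A) -> open A.
Proof. by []. Qed.

(** The saturation of A is a union of translates of A.  Openness of the projection is
    what makes the operations of the quotient continuous and separates its
    points. *)
Lemma quotient_proj_open (A : set G) : open A -> open (q @` A).
Proof.
move=> Ao; apply: quotient_open_preimage.
have -> : q @^-1` (q @` A) = \bigcup_(n in N) ((fun x => n * x) @^-1` A).
  apply/seteqP; split=> x /=.
    move=> [a Aa /quotient_projP Nax]; exists (a * x^-1) => //=.
    by rewrite mulgVK.
  by move=> [n Nn /= Anx]; exists (n * x) => //; apply/quotient_projP; rewrite mulgK.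
apply: bigcup_open => n _; apply: open_comp => // x _.
by apply: (@continuous_translate G G id n) => ?; exact: cvg_id.
Qed.

Let mul_continuous : continuous (fun x : Q * Q => x.1 * x.2).
Proof.
move=> [x y]; have [a <-] := quotient_proj_surj x; have [b <-] := quotient_proj_surj y.
move=> U /=; rewrite -[q a * q b]/(quotient_mul _ _) quotient_mulE => qU.
have [[A B] /= [nA nB] AB] := @mulg_continuous G (a, b) _ (quotient_proj_continuous qU).
rewrite nbhsE in nA; case: nA => A' [A'o A'a] A'A.
rewrite nbhsE in nB; case: nB => B' [B'o B'b] B'B.
exists (q @` A', q @` B') => /=.
  split; apply: open_nbhs_nbhs; split; try exact: quotient_proj_open.
    by exists a.
  by exists b.
move=> [_ _] /= [[a' Aa' <-] [b' Bb' <-]].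
rewrite -[q a' * q b']/(quotient_mul _ _) quotient_mulE.
exact: (AB (a', b') (conj (A'A _ Aa') (B'B _ Bb'))).
Qed.

Let inv_continuous : continuous (fun x : Q => x^-1).
Proof.
move=> x; have [a <-] := quotient_proj_surj x.
move=> U /=; rewrite -[(q a)^-1]/(quotient_inv _) quotient_invE => qU.
have := @invg_continuous G a _ (quotient_proj_continuous qU).
rewrite /= nbhs_simpl/= nbhsE => -[A [Ao Aa] AU].
rewrite nbhs_simpl/= nbhsE; exists (q @` A).
  by split; [exact: quotient_proj_open|exists a].
move=> _ [b Ab <-] /=; rewrite -[(q b)^-1]/(quotient_inv _) quotient_invE.
exact: AU.
Qed.

HB.instance Definition _ := Group_isTopologicalGroup.Build Q mul_continuous inv_continuous.

Lemma quotient_proj_hom : continuous_hom (q : G -> (Q : topologicalGroupType)).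
Proof.
split; first exact: quotient_proj_continuous.
by move=> x y; rewrite -quotient_mulE.
Qed.

Lemma quotient_proj_kernel x : q x = 1 <-> N x.
Proof. by rewrite -[1]/(q 1) quotient_projP invg1 mulg1. Qed.

Lemma quotient_compact_group : compact_group G -> closed N ->
  compact_group (Q : topologicalGroupType).
Proof.
move=> [Gc Gh] Ncl; split.
  have <- : range q = [set: Q].
    by apply/seteqP; split => // z _; have [x <-] := quotient_proj_surj z; exists x.
  apply: continuous_compact => //; apply: continuous_subspaceT; exact: quotient_proj_continuous.
rewrite open_hausdorff => x y.
have [a <-] := quotient_proj_surj x; have [b <-] := quotient_proj_surj y.
move=> /eqP ab.
have cab : continuous (fun z : G * G => z.1 * z.2^-1).
  apply: continuous_mulg => [z|]; first exact: cvg_fst.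
  by apply: (@continuous_invg _ _ snd) => z; exact: cvg_snd.
have nab : ~ N (a * b^-1) by move=> /quotient_projP.
have nN : nbhs (a * b^-1) (~` N).
  by apply: open_nbhs_nbhs; split => //; exact: closed_openC.
have [[A B] /= [nA nB] AB] := cab (a, b) _ nN.
rewrite nbhsE in nA; case: nA => A' [A'o A'a] A'A.
rewrite nbhsE in nB; case: nB => B' [B'o B'b] B'B.
exists (q @` A', q @` B'); rewrite /=.
  by split; apply/mem_set; [exists a|exists b].
split; try exact: quotient_proj_open.
apply/eqP; rewrite -subset0 => _ [[a' Aa' <-] [b' Bb' /esym/quotient_projP]].
exact: (AB (a', b') (conj (A'A _ Aa') (B'B _ Bb'))).
Qed.

End Quotient.

Lemma exists_quotient_group (G : topologicalGroupType) (N : set G) :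
  compact_group G -> abelian_group G -> subgroup_set N -> closed N ->
  exists (H : topologicalGroupType) (q : G -> H),
    [/\ compact_group H, continuous_hom q, forall y, exists x, q x = y &
        forall x, q x = 1%g <-> N x].
Proof.
move=> Gcompact Gab Nsub Ncl.
exists (quotient_group Nsub Gab : topologicalGroupType), (quotient_proj Gab Nsub).
split; [exact: quotient_compact_group|exact: quotient_proj_hom|
  exact: quotient_proj_surj|exact: quotient_proj_kernel].
Qed.

(** * The inverse sequence of a family of characters *)

(** A continuous surjection from a compact space onto a Hausdorff space is closed,
    hence a quotient map. *)
Lemma quotient_map_continuous (X Y Z : topologicalType)
    (p : X -> Y) (f : X -> Z) (g : Y -> Z) :
  compact [set: X] -> hausdorff_space Y -> continuous p ->
  (forall y, exists x, p x = y) -> continuous f -> (forall x, g (p x) = f x) ->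
  continuous g.
Proof.
move=> Xc Yh pc psurj fc gpf; apply/continuous_closedP => C Ccl.
have -> : g @^-1` C = p @` (f @^-1` C).
  apply/seteqP; split=> [y /= Cgy|_ [x Cfx <-]]; last by rewrite /= gpf.
  by have [x xy] := psurj y; exists x => //=; rewrite -gpf xy.
apply: compact_closed => //; apply: continuous_compact.
  exact: continuous_subspaceT.
by apply: (subclosed_compact _ Xc) => //; apply: closed_comp => // x _; exact: fc.
Qed.

(** Used both to lift a compatible family to G and to prove that the induced map into
    a limit stage is continuous. *)
Lemma compact_nested_intersection (d : Order.disp_t) (I : orderType d) (P : set I)
    (T : topologicalType) (D : I -> set T) :
  compact [set: T] -> P !=set0 ->
  (forall a, P a -> closed (D a)) -> (forall a, P a -> D a !=set0) ->
  (forall a b, (a <= b)%O -> P a -> P b -> D b `<=` D a) ->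
  exists x, forall a, P a -> D a x.
Proof.
move=> Tc [a0 Pa0] Dcl Dne Dmono.
have FP : ProperFilter (filter_from P D).
  apply: filter_from_proper => //.
  apply: filter_from_filter; first by exists a0.
  move=> a b Pa Pb; have [ab|/ltW ba] := leP a b.
    by exists b => // x Dx; split => //; exact: Dmono ab _ _ _ Dx.
  by exists a => // x Dx; split => //; exact: Dmono ba _ _ _ Dx.
have [x [_ clx]] := Tc _ FP filterT.
exists x => a Pa; apply: Dcl => // B nB.
by have [y [Dy By]] := clx (D a) B (ex_intro2 _ _ a Pa (fun x => id)) nB; exists y.
Qed.

Lemma prod_hausdorff (X Y : topologicalType) :
  hausdorff_space X -> hausdorff_space Y -> hausdorff_space (X * Y)%type.
Proof.
move=> Xh Yh [x y] [x' y'] h; congr (_, _).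
  by apply: Xh; apply: (continuous_cluster (f := fst)) h => z; exact: cvg_fst.
by apply: Yh; apply: (continuous_cluster (f := snd)) h => z; exact: cvg_snd.
Qed.

Section Homomorphisms.
Local Open Scope group_scope.
Context {G H : topologicalGroupType} {f : G -> H} (fh : continuous_hom f).

Lemma hom1 : f 1 = 1.
Proof. by apply: (mulgI (f 1)); rewrite -fh.2 !mulg1. Qed.

Lemma homV x : f x^-1 = (f x)^-1.
Proof. by apply: (mulgI (f x)); rewrite -fh.2 !mulgV hom1. Qed.

Lemma hom_eq x y : f x = f y <-> f (x * y^-1) = 1.
Proof.
rewrite fh.2 homV; split=> [->|xy]; first by rewrite mulgV.
by rewrite -[LHS](mulgVK (f y)) xy mul1g.
Qed.
End Homomorphisms.

Section System.
Local Open Scope group_scope.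
Variables (R : realType) (d : Order.disp_t) (I : tbOrderType d).
Variable G : topologicalGroupType.
Hypothesis Gcompact : compact_group G.
Hypothesis Gabelian : abelian_group G.
Variable chi : I -> G -> circle_group R.
Hypothesis chi_hom : forall a, continuous_hom (chi a).
Hypothesis chi_sep : forall x, x <> 1 -> exists2 a, (a < \top)%O & chi a x <> 1.

Definition kernel_below (a : I) : set G := [set x | forall b, (b < a)%O -> chi b x = 1].
Local Notation N := kernel_below.

Lemma kernel_below_mono a b : (a <= b)%O -> N b `<=` N a.
Proof. by move=> ab x Nx c ca; apply: Nx; exact: lt_le_trans ca ab. Qed.

Lemma kernel_below_subgroup a : subgroup_set (N a).
Proof.
split=> [b _|x y Nx Ny b ba]; first exact: hom1 (chi_hom b).
by apply/(hom_eq (chi_hom b)); rewrite Nx ?Ny.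
Qed.

Lemma kernel_below_closed a : closed (N a).
Proof.
have -> : N a = \bigcap_(b in [set b | (b < a)%O]) (chi b @^-1` [set 1]).
  by apply/seteqP; split.
apply: closed_bigI => b _; apply: closed_comp.
  by move=> x _; have [cc _] := chi_hom b; exact: cc.
by apply: accessible_closed_set1; apply: hausdorff_accessible; exact: circle_hausdorff.
Qed.

(** At the top the kernel is trivial, and G itself is taken instead of its isomorphic
    copy G / 1, so that the limit of the sequence is G on the nose. *)
Lemma exists_stage (a : I) : exists p : {H : topologicalGroupType & G -> H},
  [/\ [/\ compact_group (projT1 p), continuous_hom (projT2 p),
      forall y, exists x, projT2 p x = y & forall x, projT2 p x = 1 <-> N a x] &
      a = \top%O -> projT1 p = G].
Proof.
have [->|aT] := eqVneq a \top%O.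
  exists (existT _ G id); split => //; split => //=.
  - by split=> // x; exact: cvg_id.
  - by move=> y; exists y.
  - move=> x; split=> [->|Nx]; first by case: (kernel_below_subgroup \top%O).
    by apply: contrapT => /chi_sep[b bT]; apply; exact: Nx.
have [H [q [? ? ? ?]]] := exists_quotient_group Gcompact Gabelian
  (kernel_below_subgroup a) (@kernel_below_closed a).
by exists (existT _ H q); split => // /eqP; rewrite (negbTE aT).
Qed.

Let stage_pack := choice exists_stage.
Let stage (a : I) : topologicalGroupType := projT1 (projT1 stage_pack a).
Let proj (a : I) : G -> stage a := projT2 (projT1 stage_pack a).

Let stage_compact a : compact_group (stage a).
Proof. by case: (projT2 stage_pack a) => -[h1 h2 h3 h4] _; exact: h1. Qed.
Let proj_hom a : continuous_hom (proj a).
Proof. by case: (projT2 stage_pack a) => -[h1 h2 h3 h4] _; exact: h2. Qed.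
Let proj_surj a y : exists x, proj a x = y.
Proof. by case: (projT2 stage_pack a) => -[h1 h2 h3 h4] _; exact: h3. Qed.
Let proj_kernel a x : proj a x = 1 <-> N a x.
Proof. by case: (projT2 stage_pack a) => -[h1 h2 h3 h4] _; exact: h4. Qed.
Let stage_top : stage \top%O = G.
Proof. by have [_] := projT2 stage_pack \top%O; apply. Qed.

Let proj_eq a x y : proj a x = proj a y <-> N a (x * y^-1).
Proof. by rewrite (hom_eq (proj_hom a)) proj_kernel. Qed.

Let lift a (y : stage a) : G := sval (cid (proj_surj y)).
Let liftK a (y : stage a) : proj a (lift y) = y.
Proof. by rewrite /lift; case: cid. Qed.

Let stage_bond (a b : I) (ab : (a <= b)%O) (y : stage b) : stage a := proj a (lift y).

Let stage_bondE a b (ab : (a <= b)%O) x : stage_bond ab (proj b x) = proj a x.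
Proof. by apply/proj_eq/(kernel_below_mono ab)/proj_eq; rewrite liftK. Qed.

(** Every map of the construction is induced by a homomorphism defined on G. *)
Let stage_hom a (H : topologicalGroupType) (f : G -> H) (g : stage a -> H) :
  continuous_hom f -> (forall x, g (proj a x) = f x) -> continuous_hom g.
Proof.
move=> [fc fM] gf; split.
  apply: (quotient_map_continuous Gcompact.1 (stage_compact a).2 (proj_hom a).1) fc gf.
  exact: proj_surj.
move=> x y; have [x' <-] := proj_surj x; have [y' <-] := proj_surj y.
by rewrite -(proj_hom a).2 !gf fM.
Qed.

Let stage_bond_hom a b (ab : (a <= b)%O) : continuous_hom (stage_bond ab).
Proof. exact: stage_hom (proj_hom a) (stage_bondE ab). Qed.

Let stage_bond_id a (aa : (a <= a)%O) x : stage_bond aa x = x.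
Proof. by have [x' <-] := proj_surj x; rewrite stage_bondE. Qed.

Let stage_bond_comp a b c (ab : (a <= b)%O) (bc : (b <= c)%O) (ac : (a <= c)%O) x :
  stage_bond ab (stage_bond bc x) = stage_bond ac x.
Proof. by have [x' <-] := proj_surj x; rewrite !stage_bondE. Qed.

Definition character_system : inverse_sequence I :=
  InverseSequence stage_compact stage_bond_hom stage_bond_id stage_bond_comp.
Local Notation S := character_system.

Lemma character_system_top : obj S \top%O = G.
Proof. exact: stage_top. Qed.

Lemma character_system_bot : trivial_group (obj S \bot%O).
Proof.
move=> y; have [x <-] := proj_surj y; apply/proj_kernel => b.
by rewrite ltNge le0x.
Qed.

(** For x in X the sets of elements of G lying over f a x are closed, nonempty and
    nested for a < delta, so they have a common element, whose class is the value
    u x.  It is unique because the kernel at a limit is the intersection of the earlier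
    kernels. *)
Lemma character_system_continuous : continuous_sequence S.
Proof.
move=> delta [delta0 limit_delta] X f fhom fcomp.
have [Gc Gh] := Gcompact.
have stage_inj (y y' : stage delta) :
    (forall a (ad : (a < delta)%O),
       stage_bond (ltW ad) y = stage_bond (ltW ad) y') -> y = y'.
  have [x <-] := proj_surj y; have [x' <-] := proj_surj y' => h.
  apply/proj_eq => b bd.
  have [a ba ad] : exists2 a, (b < a)%O & (a < delta)%O.
    apply: contrapT => na; apply: limit_delta; exists b; split => // c bc.
    by rewrite leNgt; apply/negP => cd; apply: na; exists c.
  by have := h a ad; rewrite !stage_bondE => /proj_eq; apply.
have ex x : exists y : stage delta,
    forall a (ad : (a < delta)%O), stage_bond (ltW ad) y = f a ad x.
  pose D a := [set g : G | forall ad : (a < delta)%O, proj a g = f a ad x].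
  have [||||g gD] := @compact_nested_intersection _ I [set a | (a < delta)%O] G D Gc.
  - by exists \bot%O.
  - move=> a ad; have -> : D a = proj a @^-1` [set f a ad x].
      apply/seteqP; split=> g /=; first exact.
      by move=> gf ad'; rewrite gf (Prop_irrelevance ad ad').
    apply: closed_comp; first by move=> z _; exact: (proj_hom a).1.
    exact/accessible_closed_set1/hausdorff_accessible/(stage_compact a).2.
  - move=> a ad; have [g gf] := proj_surj (f a ad x).
    by exists g => ad'; rewrite gf (Prop_irrelevance ad ad').
  - move=> a b ab ad bd g Dg ad'.
    by rewrite -(stage_bondE ab) (Dg bd); exact: fcomp.
  exists (proj delta g) => a ad; rewrite stage_bondE; exact: gD.
have [u uP] := choice ex.
exists u; split; last first.
  move=> u' [_ u'P]; apply/funext => x; apply: stage_inj => a ad.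
  by rewrite uP; exact/esym/u'P.
split=> //; split; last first.
  move=> x y; apply: stage_inj => a ad.
  by rewrite (stage_bond_hom _).2 !uP (fhom a ad).2.
move=> x W nW; have [V [Vo Vux] VW] : exists2 V, open_nbhs (u x) V & V `<=` W.
  by move: nW; rewrite /= nbhsE.
(* By compactness of the complement of V, some stage a already separates f a x from
   the image of that complement; the preimage of this separation under f a is the
   desired neighbourhood. *)
suff [a [ad aV]] : exists a (ad : (a < delta)%O), ~ (stage_bond (ltW ad) @` (~` V)) (f a ad x).
  have Ccl : closed (stage_bond (ltW ad) @` (~` V)).
    apply: compact_closed; first exact: (stage_compact a).2.
    apply: continuous_compact.
      by apply: continuous_subspaceT; exact: (stage_bond_hom _).1.
    apply: (subclosed_compact _ (stage_compact delta).1) => //.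
    exact: open_closedC.
  have := (fhom a ad).1 x _ (open_nbhs_nbhs (conj (closed_openC Ccl) aV)).
  change (nbhs x (f a ad @^-1` ~` (stage_bond (ltW ad) @` (~` V))) -> nbhs x (u @^-1` W)).
  apply: filterS => x' /= nx'; apply: VW; apply: contrapT => nV.
  by apply: nx'; exists (u x') => //; exact: uP.
apply: contrapT => nex.
pose D a := [set y : stage delta | ~ V y /\
  forall ad : (a < delta)%O, stage_bond (ltW ad) y = f a ad x].
have [||||y yD] := @compact_nested_intersection _ I [set a | (a < delta)%O] (stage delta) D
    (stage_compact delta).1.
- by exists \bot%O.
- move=> a ad; have -> : D a = ~` V `&` stage_bond (ltW ad) @^-1` [set f a ad x].
    apply/seteqP; split=> y /= [nV h]; split => //.
    by move=> ad'; rewrite (Prop_irrelevance ad' ad).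
  apply: closedI; first exact: open_closedC.
  apply: closed_comp; first by move=> z _; exact: (stage_bond_hom _).1.
  exact/accessible_closed_set1/hausdorff_accessible/(stage_compact a).2.
- move=> a ad; apply: contrapT => nD; apply: nex; exists a, ad => -[y nV yf].
  by apply: nD; exists y; split => // ad'; rewrite (Prop_irrelevance ad' ad).
- move=> a b ab ad bd y [nV yf]; split => // ad'.
  by rewrite -(stage_bond_comp ab (ltW bd)) yf; exact: fcomp.
have [nV _] := yD _ delta0; apply: nV.
suff -> : y = u x by [].
by apply: stage_inj => a ad; rewrite uP; have [_ ->] := yD a ad.
Qed.

Lemma kernel_below_succ a b : is_successor a b -> forall x, N b x <-> N a x /\ chi a x = 1.
Proof.
move=> [ab bmin] x; split=> [Nx|[Nx chix] c cb].
  by split; [exact: kernel_below_mono (ltW ab) _ Nx|exact: Nx].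
have [ca|ac|->//] := ltgtP c a; first exact: Nx.
by have := bmin c ac; rewrite leNgt cb.
Qed.

(** The character chi a identifies the kernel of the step, N a / N b, with the closed
    subgroup K of the circle. *)
Lemma character_system_step (a b : I) (ab : is_successor a b) :
  finite_kernel_step S (ltW (proj1 ab)) \/ circle_step S R (ltW (proj1 ab)).
Proof.
have Nb := kernel_below_succ ab.
have [Gc Gh] := Gcompact.
have [chic chiM] := chi_hom a.
set ab' := ltW _.
pose K := chi a @` N a.
have [N1 NV] := kernel_below_subgroup a.
have NV' x : N a x -> N a x^-1 by move=> Nx; rewrite -[x^-1]mul1g; exact: NV.
have NM x y : N a x -> N a y -> N a (x * y).
  by move=> Nx /NV' Ny; rewrite -[y]invgK; exact: NV.
have [Kfin|Kinf] := pselect (finite_set K).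
  left; split.
    split; first exact: stage_bond_hom.
    move=> y _; have [x <-] := proj_surj y; exists (proj b x) => //; exact: stage_bondE.
  pose k (y : stage b) := chi a (lift y).
  have kinj : {in Defs.kernel (stage_bond ab') &, injective k}.
    move=> y y' /set_mem ky /set_mem ky' kk.
    rewrite -(liftK y) -(liftK y'); apply/proj_eq/Nb; split.
      by apply: NV; apply/proj_kernel.
    by apply/(hom_eq (chi_hom a)).
  rewrite -[finite_set _](eq_finite_set (inj_card_eq kinj)).
  apply: sub_finite_set Kfin => _ [y ky <-]; exists (lift y) => //.
  by apply/proj_kernel.
have KT : K = setT.
  apply: circle_closed_subgroup Kinf.
  - apply: compact_closed; first exact: circle_hausdorff.
    apply: continuous_compact; first exact: continuous_subspaceT.
    by apply: (subclosed_compact _ Gc) => //; exact: kernel_below_closed.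
  - by exists 1 => //; exact: hom1 (chi_hom a).
  - by move=> _ _ [x Nx <-] [y Ny <-]; exists (x * y); [exact: NM|exact: chiM].
  - by move=> _ [x Nx <-]; exists x^-1; [exact: NV'|exact: homV (chi_hom a) x].
right.
pose f (x : G) : (stage a * circle_group R)%type := (proj a x, chi a x).
have fh : continuous_hom f.
  split; last by move=> x y; rewrite /f (proj_hom a).2 chiM.
  by move=> x; exact: (cvg_pair ((proj_hom a).1 x) (chic x)).
pose h (y : stage b) : (stage a * circle_group R)%type := f (lift y).
have hE x : h (proj b x) = f x.
  have /proj_eq/Nb[h1 h2] := liftK (proj b x).
  by rewrite /h /f; congr (_, _); [exact/proj_eq|exact/(hom_eq (chi_hom a))].
have hh := stage_hom fh hE.
have h_surj z : exists y, h y = z.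
  case: z => y t; have [x xy] := proj_surj y.
  have [n Nn nt] : K (t * (chi a x)^-1) by rewrite KT.
  (* Correcting by n in N a changes the character but not the class modulo N a. *)
  exists (proj b (n * x)); rewrite hE /f chiM nt mulgVK; congr (_, _).
  by rewrite -xy; apply/proj_eq; rewrite mulgK.
have h_inj : injective h.
  move=> y y'; have [x <-] := proj_surj y; have [x' <-] := proj_surj y'.
  rewrite !hE => -[/proj_eq h1 /(hom_eq (chi_hom a)) h2].
  by apply/proj_eq/Nb.
pose g z := sval (cid (h_surj z)).
have hg : cancel g h by move=> z; rewrite /g; case: cid.
have gh : cancel h g by move=> y; apply: h_inj; rewrite hg.
exists h; split; last by move=> y; have [x <-] := proj_surj y; rewrite hE [RHS]stage_bondE.
split => //; exists g; split => //; split.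
  apply: (quotient_map_continuous (p := h) (f := id) (stage_compact b).1) => //.
  - by apply: prod_hausdorff; [exact: (stage_compact a).2|exact: circle_hausdorff].
  - exact: hh.1.
  - by move=> x; exact: cvg_id.
by move=> z z'; apply: h_inj; rewrite hh.2 !hg.
Qed.

End System.

(** * Separating families indexed by the weight *)

(** One character per basic open set is enough, because a character which is not 1 at
    a point is not 1 on a basic neighbourhood of it. *)
Lemma exists_separating_characters (R : realType) (G : topologicalGroupType)
    (d : Order.disp_t) (I : tbOrderType d) :
  compact_group G -> abelian_group G -> weight_eq G (\top%O : I) ->
  exists2 chi : I -> G -> circle_group R, forall a, continuous_hom (chi a) &
    forall x, x <> 1%g -> exists2 a, (a < \top)%O & chi a x <> 1%g.
Proof.
move=> Gcompact Gab [_ [B [Bo Bb] /card_set_bijP[f [_ _ fsurj]]] _].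
pose nontrivial_on (U : set G) (c : G -> circle_group R) :=
  continuous_hom c /\ forall u, U u -> c u <> 1%g.
have ex a : exists c : G -> circle_group R, continuous_hom c /\
    ((exists c', nontrivial_on (f a) c') -> nontrivial_on (f a) c).
  have [[c cU]|nc] := pselect (exists c, nontrivial_on (f a) c).
    by exists c; split => //; case: cU.
  exists (fun=> 1%g); split => //; split; first by move=> x; exact: cvg_cst.
  by move=> x y; rewrite mulg1.
have [chi chiP] := choice ex.
exists chi => [a|x x1]; first by case: (chiP a).
have [c ch cx] := exists_character R Gcompact Gab x1.
have : nbhs x (c @^-1` (~` [set 1%g])).
  apply: open_nbhs_nbhs; split => //; apply: open_comp.
    by move=> y _; exact: ch.1.
  apply: closed_openC; apply: accessible_closed_set1; apply: hausdorff_accessible.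
  exact: circle_hausdorff.
move=> /Bb[U [BU Ux] Uc]; have [a aT aU] := fsurj _ BU.
exists a => //; case: (chiP a) => _ [|_]; last by apply; rewrite aU.
by exists c; split => // u; rewrite aU => /Uc.
Qed.

Theorem proposition2p9 (R : realType) (G : topologicalGroupType)
    (G_compact : compact_group G) (G_abelian : abelian_group G) :
  exists (d : Order.disp_t) (I : tbOrderType d) (S : inverse_sequence I),
    [/\ wochoice.well_order (fun a b : I => (a <= b)%O),
        continuous_sequence S,
        obj S \top%O = G,
        trivial_group (obj S \bot%O) &
        (forall (a b : I) (ab : is_successor a b),
            finite_kernel_step S (ltW (proj1 ab)) \/
            circle_step S R (ltW (proj1 ab)))] /\
    (~ compact_lie_group G -> weight_eq G (\top%O : I)).
Proof.
have [d [I [Iwo Iweight]]] := exists_weight_order G.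
have [chi chi_hom chi_sep] :=
  exists_separating_characters R G_compact G_abelian Iweight.
exists d, I, (character_system G_compact G_abelian chi_hom chi_sep).
split; last by [].
split; first exact: Iwo.
- exact: character_system_continuous.
- exact: character_system_top.
- exact: character_system_bot.
- exact: character_system_step.
Qed.
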